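(* Let $T$ be the (unrooted) infinite tree in which every vertex is the endpoint of exactly three edges. There are absolute constants $0<c\le C<\infty$ such that the following holds. Let $\mu\ge0$ be a Borel probability measure on $\overline{T}=T\cup\partial T$ giving no mass to vertices and which is not a Dirac delta at a point of $\partial T$. Then, in $[0,+\infty]$, any two of the three quantities $$[\mu]_{inv},\qquad \inf_{o\in T}[\mu]_o,\qquad \sup_{A,B\subseteq\partial T}\frac{\mu(A)\mu(B)}{\mathrm{Cap}(A,B)}$$ are comparable, with comparability constants $c,C$; the supremum is over all pairs of disjoint nonempty sets $A,B\subseteq\partial T$ each of which is a finite union of arcs.
   Context: $T$ also denotes the vertex set and $E$ the set of edges. $\partial T$ is the boundary (space of ends) of $T$: for any choice of a vertex $o$, it is identified with the set of infinite geodesics starting at $o$. $\overline{T}=T\cup\partial T$ has the usual compact topology. An arc is the boundary in $\partial T$ of one of the two subtrees obtained by removing an edge from $T$ (i.e. the set of ends of that subtree). For $F:T\to\mathbb{R}$ and an edge $\alpha$ with endpoints $x,y$, $|\nabla F(\alpha)|=|F(x)-F(y)|$. Functions $F$ are taken with $|\nabla F|$ finitely supported, and are extended to $\partial T$ by their eventually constant values along geodesics. $[\mu]_o\in[0,+\infty]$ is the best constant in $$\int_{\overline{T}}|F(x)|^2d\mu(x)\le[\mu]_o\Big(|F(o)|^2+\sum_{\alpha\in E}|\nabla F(\alpha)|^2\Big)\quad\text{for all }F,$$ and $[\mu]_{inv}\in[0,+\infty]$ is the best constant in $$\int_{\overline{T}}|F(x)-\mu(F)|^2d\mu(x)\le[\mu]_{inv}\sum_{\alpha\in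 E}|\nabla F(\alpha)|^2\quad\text{for all }F,\qquad \mu(F)=\int_{\overline{T}}F\,d\mu.$$ For disjoint $A,B\subseteq\partial T$, each a finite union of arcs, the condenser capacity is $$\mathrm{Cap}(A,B)=\inf\Big\{\sum_{\alpha\in E}|\nabla F(\alpha)|^2:\ F|_A=1,\ F|_B=0,\ |\nabla F|\text{ has finite support}\Big\}.$$ *)

(* Defs.v *)
From HB Require Import structures.
From mathcomp Require Import all_boot all_order all_algebra.
From mathcomp Require Import all_classical all_reals all_analysis.
Set Implicit Arguments.
Unset Strict Implicit.
Unset Printing Implicit Defensive.
Import Order.TTheory GRing.Theory Num.Theory.
Import numFieldNormedType.Exports.
Local Open Scope classical_set_scope.
Local Open Scope ring_scope.

(* Such a tree, when nonempty, is unique up to isomorphism. A cycle of size 2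
   just goes back and forth along an edge. *)
Record cubicTree := CubicTree {
  vertex :> choiceType;
  adj : rel vertex;
  adj_sym : symmetric adj;
  adj_irr : irreflexive adj;
  tree_connected : forall x y, exists2 p, path adj x p & y = last x p;
  tree_acyclic : forall p, ucycle adj p -> (size p <= 2)%N;
  tree_cubic : forall x, ([set y | adj x y] #= `I_3)%card }.

Section Tree.
Variable T : cubicTree.

Definition geodesic (g : nat -> T) : Prop :=
  (forall n, adj (g n) (g n.+1)) /\
  forall m n p, path (@adj T) (g m) p -> last (g m) p = g n ->
    (n - m <= size p)%N.

(* The connected component of y once the edge {x, y} has been removed. *)
Definition adj_without (x y : T) : rel T :=
  [rel u v | adj u v && ((u, v) \notin [:: (x, y); (y, x)])].
Definition subtree (x y : T) : set T :=
  [set z | exists2 p, path (adj_without x y) y p & z = last y p].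

(* r is an arbitrary reference vertex: an end is represented by the unique
   geodesic ray from r in its class. *)
Variable r : T.

Record boundary := Ray {
  ray :> nat -> T;
  ray0 : ray 0%N = r;
  ray_geodesic : geodesic ray }.

Definition arc (x y : T) : set boundary :=
  [set xi | \forall n \near \oo, subtree x y (xi n)].

Definition is_arc (A : set boundary) : Prop :=
  exists x y : T, adj x y /\ A = arc x y.

Definition finite_union_of_arcs (A : set boundary) : Prop :=
  exists (n : nat) (B : 'I_n -> set boundary),
    (forall i, is_arc (B i)) /\ A = \bigcup_i B i.

Inductive Tbar := Vertex of T | End of boundary.

HB.instance Definition _ := gen_eqMixin Tbar.
HB.instance Definition _ := gen_choiceMixin Tbar.
HB.instance Definition _ := isPointed.Build Tbar (Vertex r).

Definition subtree_bar (x y : T) : set Tbar :=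
  (Vertex @` subtree x y) `|` (End @` arc x y).

(* Generated by the completed subtrees; vertices are isolated, a vertex being
   the intersection of the three completed subtrees containing it that are cut
   off by its incident edges. *)
HB.instance Definition _ := @isSubBaseTopological.Build Tbar (set Tbar)
  [set U | exists x y : T, adj x y /\ U = subtree_bar x y] id.

Definition borelTbar := g_sigma_algebraType (@open Tbar).

Variable R : realType.
Implicit Types (F : T -> R) (mu : {measure set borelTbar -> \bar R}).
Implicit Types A B : set boundary.

(* Edges appear as ordered pairs, hence twice each. *)
Definition fin_grad F : Prop :=
  finite_set [set e : T * T | adj e.1 e.2 /\ `|F e.1 - F e.2| != 0].

Definition energy F : R :=
  (\sum_(e \in [set e : T * T | adj e.1 e.2]) `|F e.1 - F e.2| ^+ 2) / 2.

(* When fin_grad F holds, F \o xi is eventually constant and the limit is its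
   eventual value. *)
Definition extend F (z : borelTbar) : R :=
  match z with
  | Vertex x => F x
  | End xi => lim (F \o xi @ \oo)
  end.

(* Best constants: the infimum of the empty set is +oo. *)
Definition carleson_const mu (o : T) : \bar R :=
  ereal_inf [set K%:E | K in [set K : R | 0 <= K /\
    forall F, fin_grad F ->
      (\int[mu]_z (`|extend F z| ^+ 2)%:E
        <= (K * (`|F o| ^+ 2 + energy F))%:E)%E]].

Definition mean mu F : R := \int[mu]_z extend F z.

Definition poincare_const mu : \bar R :=
  ereal_inf [set K%:E | K in [set K : R | 0 <= K /\
    forall F, fin_grad F ->
      (\int[mu]_z (`|extend F z - mean mu F| ^+ 2)%:E
        <= (K * energy F)%:E)%E]].

Definition capacity A B : \bar R :=
  ereal_inf [set (energy F)%:E | F in [set F | [/\ fin_grad F,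
    forall xi, A xi -> extend F (End xi) = 1 &
    forall xi, B xi -> extend F (End xi) = 0]]].

Definition capacity_const mu : \bar R :=
  ereal_sup [set q | exists A B,
    [/\ finite_union_of_arcs A, finite_union_of_arcs B,
        A !=set0, B !=set0 & A `&` B = set0] /\
    q = (mu (End @` A) * mu (End @` B) / capacity A B)%E].

Definition is_boundary_dirac mu : Prop :=
  exists xi : boundary, forall S : set borelTbar, measurable S ->
    mu S = dirac (End xi : borelTbar) S.

End Tree.

Definition comparable_with (R : realType) (c C : R) (X Y : \bar R) : Prop :=
  (c%:E * X <= Y /\ Y <= C%:E * X)%E.

(* Main.v *)
Require Import Defs.
From HB Require Import structures.
From mathcomp Require Import all_boot all_order all_algebra.
From mathcomp Require Import all_classical all_reals all_analysis.
From mathcomp Require Import measurable_realfun ring lra.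
Set Implicit Arguments.
Unset Strict Implicit.
Unset Printing Implicit Defensive.
Import Order.TTheory GRing.Theory Num.Theory.
Import numFieldNormedType.Exports.
Import Defs.
Local Open Scope classical_set_scope.
Local Open Scope ring_scope.

(** The three constants are compared in a cycle: capacity constant <= Poincare
    constant <= infimum of the Carleson constants <= 192 times the capacity
    constant.

    The first inequality tests the Poincare inequality on competitors of a
    condenser ([poincare_set_cap_bound]); the second holds because, among
    constants, the mean is closest to a function in quadratic mean
    ([variance_le]).

    For the third, suppose that the capacity constant is at most a finite [M].
    The measure then has a center: a vertex [o] all of whose branches have mass
    at most one half ([exists_center]). Otherwise every vertex has a branch of
    mass larger than one half; following these branches gives a geodesic ray,
    and as condensers between its far branches and a fixed side branch have
    capacity tending to zero, every side branch is null and the measure is a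
    Dirac mass at the end of the ray ([heavy_ray_dirac]). Some branch at the
    center has mass between a third and a half, which bounds [M] from below
    ([center_lower_bound]).

    At the center, a capacitary strong type inequality in the manner of Maz'ya
    applies. Let [G] vanish at [o]. For [b > 0] and a branch at [o], the part of
    the branch where [|G| >= 2 b] and the complement of the branch are the plates
    of a condenser, and [|G|] truncated between [b] and [2 b] and restricted to
    the branch is a multiple of a competitor. As the second plate has mass at
    least one half, the capacity bound controls the mass of the first by the
    energy of the truncation ([capacitary_weak_type]). Summing over dyadic [b]
    bounds the integral of [G^2] by its energy ([center_carleson]), because the
    energies of the truncations add up to at most that of [G] and the truncations
    are finitely many, a function with finitely supported gradient having finite
    range.

    Plates have to be finite unions of arcs: this holds for the boundary level
    sets of a function with finitely supported gradient ([level_set_arcs]). Facts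
    about the compactification are reduced to facts about vertices by means of
    the filter [approach]. *)

(** * Geometry of a cubic tree *)

Lemma iotaSr m n : iota m n.+1 = iota m n ++ [:: (m + n)%N].
Proof. by rewrite -addn1 iotaD. Qed.

Section TreeGeometry.
Variable T : cubicTree.
Implicit Types (x y z u v : T) (g : nat -> T).

Lemma connected_ind (P : T -> Prop) x :
  P x -> (forall u v, adj u v -> P u -> P v) -> forall y, P y.
Proof.
move=> Px step y; have [p pp ->] := tree_connected x y.
elim: p x Px pp => //= u p ih x Px /andP[xu up].
by apply: ih up; exact: step xu Px.
Qed.

Lemma adj_neq x y : adj x y -> x != y.
Proof. by move=> xy; apply/eqP => e; move: xy; rewrite e adj_irr. Qed.

Lemma adj_withoutC x y : adj_without x y =2 adj_without y x.
Proof. by move=> u v; rewrite /adj_without /= !inE orbC. Qed.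

Lemma adj_without_sym x y : symmetric (adj_without x y).
Proof.
move=> u v; rewrite /adj_without /= adj_sym !inE !xpair_eqE.
by rewrite [in RHS]orbC [in LHS](andbC (u == x)) [in LHS](andbC (u == y)).
Qed.

Lemma adj_without_off x y u v : adj u v -> u != x -> v != x ->
  adj_without x y u v.
Proof.
move=> uv ux vx; rewrite /adj_without /= uv !inE !xpair_eqE.
by rewrite (negbTE ux) (negbTE vx) andbF.
Qed.

Lemma subtree_root x y : subtree x y y.
Proof. by exists [::]. Qed.

Lemma subtree_adj x y u v : adj_without x y u v -> subtree x y u ->
  subtree x y v.
Proof.
move=> uv [p pp e]; exists (rcons p v); last by rewrite last_rcons.
by rewrite rcons_path pp -e.
Qed.

Lemma subtree_edge x y u v : adj_without x y u v ->
  subtree x y u <-> subtree x y v.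
Proof.
by move=> uv; split; apply: subtree_adj => //; rewrite adj_without_sym.
Qed.

(** A path from [y] to [x] avoiding the edge between them would close up with
    that edge into a cycle of length at least three. *)
Lemma subtree_avoids x y : adj x y -> ~ subtree x y x.
Proof.
move=> xy [p pp ex]; case/shortenP: pp ex => p' pp' up' _ ex.
have pa : path (@adj T) y p'.
  by apply: sub_path pp' => a b /= /andP[].
have := @tree_acyclic T (y :: p'); rewrite /ucycle /= rcons_path pa -ex xy /=.
move=> /(_ up'); case: p' pp' ex {pa up'} => [|a [|//]] /=.
  by move=> _ e; move: xy; rewrite e adj_irr.
by rewrite /adj_without /= !inE => + ea; rewrite -ea eqxx orbT andbF.
Qed.

Lemma subtree_cover x y z : subtree x y z \/ subtree y x z.
Proof.
apply: (@connected_ind (fun z => subtree x y z \/ subtree y x z) y).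
  by left; exact: subtree_root.
move=> u v uv h; have [w|] := boolP (adj_without x y u v).
  by case: h => h; [left|right]; apply: subtree_adj h => //; rewrite adj_withoutC.
rewrite /adj_without /= uv /= negbK !inE !xpair_eqE.
by case/orP => /andP[_ /eqP ->]; [left|right]; exact: subtree_root.
Qed.

Lemma subtree_disjoint x y z : adj x y -> subtree x y z -> ~ subtree y x z.
Proof.
move=> xy hz [p pp e]; apply: (subtree_avoids xy).
have back q u : path (adj_without y x) u q -> subtree x y (last u q) ->
    subtree x y u.
  elim: q u => //= v q ih u /andP[uv /ih h] /h.
  by apply: subtree_adj; rewrite adj_without_sym adj_withoutC.
by apply: back pp _; rewrite -e.
Qed.

Lemma subtree_cross x y u v : adj x y -> adj u v ->
  ~ subtree x y u -> subtree x y v -> u = x /\ v = y.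
Proof.
move=> xy uv nu hv; have [w|] := boolP (adj_without x y u v).
  by exfalso; apply: nu; exact: (subtree_edge w).2 hv.
rewrite /adj_without /= uv /= negbK !inE !xpair_eqE.
case/orP => /andP[/eqP eu /eqP ev]; first by [].
by case: nu; rewrite eu; exact: subtree_root.
Qed.

(** A walk inside the subtree beyond [z] never visits [y], so it cannot use the
    edge between [x] and [y]. *)
Lemma subtree_nested x y z : adj x y -> adj y z -> x != z ->
  subtree y z `<=` subtree x y.
Proof.
move=> xy yz xz w [p pp ->].
have hz : subtree x y z.
  apply: (@subtree_adj _ _ y z); last exact: subtree_root.
  rewrite /adj_without /= yz !inE !xpair_eqE (eq_sym z x) (negbTE xz).
  by rewrite (eq_sym y x) (negbTE (adj_neq xy)) andbF.
elim/last_ind: p pp => [//|p u ih].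
rewrite rcons_path last_rcons => /andP[pp pu].
apply: (subtree_adj _ (ih pp)); rewrite adj_withoutC.
have av v : subtree y z v -> v != y.
  by move=> hv; apply/eqP => e; apply: (subtree_avoids yz); rewrite -{2}e.
have h1 : subtree y z (last z p) by exists p.
apply: adj_without_off; [by case/andP: pu|exact: av|].
by apply: av; exact: subtree_adj pu h1.
Qed.

Lemma branch_cover x z : z = x \/ exists2 y, adj x y & subtree x y z.
Proof.
apply: (@connected_ind (fun z => z = x \/ exists2 y, adj x y & subtree x y z) x).
  by left.
move=> u v uv [eu|[y xy hu]].
  by right; exists v; [rewrite -eu|exact: subtree_root].
have [->|nvx] := eqVneq v x; [by left|right].
have [eu|nux] := eqVneq u x.
  by exists v; [rewrite -eu|exact: subtree_root].
exists y => //; apply: subtree_adj hu; exact: adj_without_off.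
Qed.

(** The only edge leading into the subtree beyond [y] ends at [y]. *)
Lemma path_enters x y u p : adj x y -> path (@adj T) u p -> ~ subtree x y u ->
  subtree x y (last u p) -> exists p1 p2, p = p1 ++ y :: p2.
Proof.
move=> xy; elim: p u => [//|v p ih] u /= /andP[uv vp] nu hl.
have [hv|nv] := pselect (subtree x y v).
  by have [_ <-] := subtree_cross xy uv nu hv; exists [::], p.
by have [p1 [p2 ->]] := ih v vp nv hl; exists (v :: p1), p2.
Qed.

Lemma adj_enum x : exists s : seq T, (size s = 3)%N /\ forall y, adj x y = (y \in s).
Proof.
have /card_set_bijP[f [fP fI fS]] := tree_cubic x.
have [a xa fa] := fS 0%N isT; have [b xb fb] := fS 1%N isT.
have [c xc fc] := fS 2%N isT; exists [:: a; b; c]; split=> // y.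
rewrite !inE; apply/idP/or3P => [xy|[]/eqP-> //].
have eqf z : adj x z -> f y = f z -> y == z.
  by move=> xz e; apply/eqP; apply: fI; rewrite ?inE.
have /= := fP y xy; case ey: (f y) => [|[|[|]]] // _.
- by constructor 1; apply: eqf; rewrite // ey.
- by constructor 2; apply: eqf; rewrite // ey.
- by constructor 3; apply: eqf; rewrite // ey.
Qed.

Lemma adj_finite x : finite_set [set y | adj x y].
Proof. by apply/finite_setP; exists 3%N; exact: tree_cubic. Qed.

Lemma vertices_countable x : countable [set: T].
Proof.
pose next (A : set T) := \bigcup_(x in A) [set y | adj x y].
have cb n : countable (iter n next [set x]).
  elim: n => [|n ih] /=; first exact: countable1.
  by apply: bigcup_countable => // y _; apply: finite_set_countable; exact: adj_finite.
have -> : [set: T] = \bigcup_n iter n next [set x].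
  apply/seteqP; split=> // y _.
  apply: (@connected_ind (\bigcup_n iter n next [set x]) x).
    by exists 0%N.
  by move=> u v uv [n _ hu]; exists n.+1 => //=; exists u.
exact: bigcup_countable.
Qed.

(** An enumeration of the vertices, by which their null sets add up. *)
Lemma vertices_enum x : exists f : nat -> T, forall y, exists n, f n = y.
Proof.
have /pfcard_geP[e|[f]] := vertices_countable x.
  by have : [set: T] x by []; rewrite e.
by exists f => y; have [n _ <-] := 'surj_f (I : [set: T] y); exists n.
Qed.

(** The union of the vertices of paths from [x] to the points of [s] is finite
    and connected. Its exit edges cut off subtrees that are disjoint from it,
    which is what makes level sets on the boundary finite unions of arcs. *)
Lemma connected_hull x (s : seq T) : exists s' : seq T,
  [/\ {subset s <= s'}, x \in s' & forall v, v \in s' ->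
    exists2 p, path (@adj T) x p /\ v = last x p & {subset p <= s'}].
Proof.
elim: s => [|w s [s' [ss' xs' hs']]].
  exists [:: x]; split=> //; first exact: mem_head.
  by move=> v; rewrite inE => /eqP ->; exists [::].
have [q pq ew] := tree_connected x w.
exists (q ++ s'); split.
- move=> v; rewrite inE mem_cat => /orP[/eqP ->|/ss' ->]; last by rewrite orbT.
  have := mem_last x q; rewrite -ew inE => /orP[/eqP ->|->//].
  by rewrite xs' orbT.
- by rewrite mem_cat xs' orbT.
move=> v; rewrite mem_cat => /orP[vq|/hs'[p pp ps]]; last first.
  by exists p => // u /ps; rewrite mem_cat => ->; rewrite orbT.
have vxq : v \in x :: q by rewrite inE vq orbT.
case/splitPl: vxq pq {ew vq} => p1 p2 e; rewrite cat_path => /andP[pp1 _].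
by exists p1 => // u up; rewrite !mem_cat up.
Qed.

Definition trail g := (forall n, adj (g n) (g n.+1)) /\ injective g.

Lemma trail_stays g x y u v N : trail g -> (forall n, (N <= n)%N -> g n != x) ->
  adj_without u v =2 adj_without x y -> subtree u v (g N) ->
  forall n, (N <= n)%N -> subtree u v (g n).
Proof.
move=> [ga _] gx e hN n /subnK <-; elim: (n - N)%N => [//|k ih].
rewrite addSn; apply: subtree_adj ih; rewrite e; apply: adj_without_off => //.
  by apply: gx; rewrite leq_addl.
by apply: gx; rewrite -addSn leq_addl.
Qed.

Lemma trail_leaves g x : trail g -> exists N, forall n, (N <= n)%N -> g n != x.
Proof.
move=> [_ gi]; have [[m e]|h] := pselect (exists m, g m = x).
  exists m.+1 => n mn; apply/eqP; rewrite -e => /gi enm.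
  by move: mn; rewrite enm ltnn.
by exists 0%N => n _; apply/eqP => e; apply: h; exists n.
Qed.

(** A trail leaves [x] for good, and from then on it cannot cross the edge
    between [x] and [y]. *)
Lemma trail_side g x y : trail g ->
  (\forall n \near \oo, subtree x y (g n)) \/
  (\forall n \near \oo, subtree y x (g n)).
Proof.
move=> tg; have [N hN] := trail_leaves x tg.
case: (subtree_cover x y (g N)) => h; [left|right]; exists N => // n /= Nn.
  exact: trail_stays tg hN _ h _ Nn.
by apply: trail_stays tg hN _ h _ Nn => ? ?; rewrite adj_withoutC.
Qed.

Lemma trail_tail g m n : trail g -> (m < n)%N ->
  subtree (g m) (g m.+1) (g n).
Proof.
move=> tg mn; apply: (@trail_stays g (g m) (g m.+1) _ _ m.+1) => //.
  move=> k mk; apply/eqP => /tg.2 e; by move: mk; rewrite e ltnn.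
exact: subtree_root.
Qed.

Lemma geodesic_trail g : geodesic g -> trail g.
Proof.
move=> [ga gm]; split=> // m n e.
apply/eqP; rewrite eqn_leq -!subn_eq0 -!leqn0.
by rewrite -[X in (_ <= X)%N && _](erefl : size ([::] : seq T) = 0%N)
  (gm n m [::]) //= (gm m n [::]).
Qed.

Lemma nonbacktracking_nested g j k : (forall n, adj (g n) (g n.+1)) ->
  (forall n, g n != g n.+2) -> (j <= k)%N ->
  subtree (g k) (g k.+1) `<=` subtree (g j) (g j.+1).
Proof.
move=> ga gb /subnKC <-; elim: (k - j)%N => [|n ih]; first by rewrite addn0.
by rewrite addnS; apply: subset_trans ih; exact: subtree_nested.
Qed.

Lemma nonbacktracking_tail g m n : (forall n, adj (g n) (g n.+1)) ->
  (forall n, g n != g n.+2) -> (m < n)%N -> subtree (g m) (g m.+1) (g n).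
Proof.
move=> ga gb; case: n => // n mn.
apply: (nonbacktracking_nested (k := n) ga gb); first by rewrite -ltnS.
exact: subtree_root.
Qed.

(** The subtrees cut off along a walk that never backtracks are nested, so any
    path from one of its vertices to a later one enters each of them in turn and
    is at least as long as the walk. *)
Lemma nonbacktracking_geodesic g : (forall n, adj (g n) (g n.+1)) ->
  (forall n, g n != g n.+2) -> geodesic g.
Proof.
move=> ga gb; split=> // m n; move: {2}(n - m)%N (erefl (n - m)%N) => k.
elim: k m => [|k ih] m e p pp el; first by rewrite e.
have mn : (m < n)%N by rewrite -subn_gt0 e.
have [||p1 [p2 ep]] := path_enters (ga m) pp.
- exact: subtree_avoids.
- by rewrite el; exact: nonbacktracking_tail.
move: pp el; rewrite ep last_cat cat_path /= => /and3P[_ _ pp2] el.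
have ekm : (n - m.+1)%N = k by rewrite subnS e.
have := ih m.+1 ekm p2 pp2 el; rewrite e ekm size_cat /= addnS ltnS => h.
by rewrite (leq_trans h) ?leq_addl.
Qed.

End TreeGeometry.

(** * The compactified tree and its Borel sets *)

Section Compactification.
Variables (T : cubicTree) (r : T).
Implicit Types (x y : T) (z : Tbar r) (xi eta : boundary r).

Lemma ray_trail xi : trail xi.
Proof. exact/geodesic_trail/ray_geodesic. Qed.

Lemma boundary_eq xi eta : (forall n, xi n = eta n) -> xi = eta.
Proof.
case: xi eta => [f f0 fg] [g g0 gg] /= /funext e; subst g.
by rewrite (Prop_irrelevance f0 g0) (Prop_irrelevance fg gg).
Qed.

(** Neighbourhood filter of a point of the compactification, traced on the
    vertices: what happens at a vertex, or eventually along a ray. *)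
Definition approach z : set_system T :=
  match z with
  | Vertex x => [set P | P x]
  | End xi => [set P | \forall n \near \oo, P (xi n)]
  end.

#[global] Instance approach_filter z : ProperFilter (approach z).
Proof.
case: z => [x|xi].
  by split=> //; split=> //= P Q PQ; exact: PQ.
have -> : approach (End xi) = xi @ \oo by [].
exact: fmap_proper_filter.
Qed.

Lemma subtree_barE x y z : subtree_bar x y z <-> approach z (subtree x y).
Proof.
split; first by case=> -[w hw <-].
by case: z => [v|xi] h; [left; exists v|right; exists xi].
Qed.

Lemma approach_side x y z :
  approach z (subtree x y) \/ approach z (subtree y x).
Proof.
by case: z => [v|xi] /=; [exact: subtree_cover|exact: trail_side (ray_trail xi)].
Qed.

Lemma subtree_barC x y : adj x y ->
  ~` subtree_bar x y = subtree_bar y x :> set (Tbar r).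
Proof.
move=> xy; apply/seteqP; split=> z /=.
  move=> nz; apply/subtree_barE; case: (approach_side x y z) => // h.
  by case: nz; apply/subtree_barE.
move=> /subtree_barE h /subtree_barE h'.
by have [v [hv hv']] := filter_ex (filterI h h'); exact: subtree_disjoint xy hv' hv.
Qed.

Lemma approach_subtree x y z : adj x y ->
  approach z (fun v => subtree x y v <-> subtree_bar x y z).
Proof.
move=> xy; have [h|h] := pselect (subtree_bar x y z).
  by apply: filterS ((subtree_barE _ _ _).1 h).
have : subtree_bar y x z by rewrite -subtree_barC.
move=> /subtree_barE; apply: filterS => v hv; split=> // hv'.
by case: (subtree_disjoint xy hv' hv).
Qed.

(** Finitely many eventual properties hold at one common vertex, which reduces
    pointwise identities on the compactification to identities on vertices. *)
Lemma approach_all (I : eqType) (P : I -> T -> Prop) z (s : seq I) :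
  (forall i, i \in s -> approach z (P i)) ->
  approach z (fun v => forall i, i \in s -> P i v).
Proof.
elim: s => [|i s ih] hs; first by apply: filterE => v i; rewrite in_nil.
have h1 := hs i (mem_head _ _).
have h2 : approach z (fun v => forall i, i \in s -> P i v).
  by apply: ih => j js; apply: hs; rewrite inE js orbT.
by apply: filterS2 h1 h2 => v vi vs j; rewrite inE => /orP[/eqP ->|/vs].
Qed.

Lemma bar_branch_cover x z : z = Vertex r x \/
  exists2 y, adj x y & subtree_bar x y z.
Proof.
case: z => [v|xi].
  case: (branch_cover x v) => [->|[y xy h]]; first by left.
  by right; exists y => //; left; exists v.
right; apply: contrapT => nh.
have [s [_ sE]] := adj_enum x.
have h1 : approach (End xi) (fun v => forall y, y \in s -> subtree y x v).
  apply: approach_all => y; rewrite -sE => xy.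
  case: (approach_side x y (End xi)) => // h.
  by case: nh; exists y => //; apply/subtree_barE.
have h2 : approach (End xi) (fun v => v != x).
  by have [N hN] := trail_leaves x (ray_trail xi); exists N.
have [v [hv /eqP vx]] := filter_ex (filterI h1 h2).
case: (branch_cover x v) => // -[y xy h].
by apply: (subtree_disjoint xy h); apply: hv; rewrite -sE.
Qed.

(** Two rays that part at their common vertex [xi m] lie on different sides of
    the next edge of [xi]; hence the arcs cut off along a ray shrink to its
    end. *)
Lemma arc_step xi eta (m : nat) : xi m = eta m :> T ->
  arc (xi m) (xi m.+1) eta -> xi m.+1 = eta m.+1 :> T.
Proof.
move=> e h; apply/eqP; apply: contrapT => /negP ne.
have [N _ hN] := h; pose n := maxn N m.+1.
have h1 : subtree (xi m) (xi m.+1) (eta n) by apply: hN; exact: leq_maxl.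
have h2 : subtree (eta m) (eta m.+1) (eta n).
  by apply: trail_tail; [exact: ray_trail|exact: leq_maxr].
have xa := (ray_trail xi).1 m; have ea := (ray_trail eta).1 m.
apply: (subtree_disjoint xa h1).
rewrite -e in h2 ea.
by apply: (subtree_nested _ ea ne h2); rewrite adj_sym.
Qed.

Lemma open_subtree_bar x y : adj x y ->
  open (subtree_bar x y : set (Tbar r)).
Proof.
move=> xy; exists [set (subtree_bar x y : set (Tbar r))]; last by rewrite bigcup_set1.
by move=> _ ->; apply: (@finI_from1 _ _ _ id); exists x, y.
Qed.

Lemma measurable_subtree_bar x y : adj x y ->
  measurable (subtree_bar x y : set (borelTbar r)).
Proof. by move=> xy; apply: sub_sigma_algebra; exact: open_subtree_bar. Qed.

(** The complement of a vertex is covered by the completed branches issued from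
    it, which are finitely many. *)
Lemma measurable_vertex x : measurable [set (Vertex r x : borelTbar r)].
Proof.
have [s [_ sE]] := adj_enum x.
have -> : [set (Vertex r x : borelTbar r)] =
    ~` (\bigcup_(y in [set` s]) subtree_bar x y).
  apply/seteqP; split=> z /=.
    move=> -> [y /= ys]; rewrite -sE in ys; move=> /subtree_barE.
    exact: subtree_avoids.
  move=> nz; case: (bar_branch_cover x z) => // -[y xy h].
  by case: nz; exists y => //=; rewrite -sE.
apply: measurableC; apply: fin_bigcup_measurable => //= y ys.
by apply: measurable_subtree_bar; rewrite sE.
Qed.

Lemma measurable_vertices (A : set T) :
  measurable (Vertex r @` A : set (borelTbar r)).
Proof.
have -> : (Vertex r @` A : set (borelTbar r)) =
    \bigcup_x (if x \in A then [set Vertex r x] else set0).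
  apply/seteqP; split=> z /=.
    by move=> [x Ax <-]; exists x => //; rewrite mem_set.
  by move=> [x _]; case: ifPn => // /set_mem Ax ->; exists x.
apply: countable_bigcupT_measurable; first exact: vertices_countable r.
by move=> x; case: ifP => _ //; exact: measurable_vertex.
Qed.

Lemma measurable_arc x y : adj x y ->
  measurable (@End T r @` arc x y : set (borelTbar r)).
Proof.
move=> xy; have -> : (@End T r @` arc x y : set (borelTbar r)) =
    subtree_bar x y `\` (Vertex r @` setT).
  apply/seteqP; split=> z /=.
    by move=> [xi h <-]; split; [right; exists xi|case].
  by case=> -[[v hv <-] []|[xi h <-] _]; [exists v|exists xi].
apply: measurableD; [exact: measurable_subtree_bar|exact: measurable_vertices].
Qed.

Lemma measurable_arcs (A : set (boundary r)) : finite_union_of_arcs A ->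
  measurable (@End T r @` A : set (borelTbar r)).
Proof.
move=> [n [B [hB ->]]]; rewrite image_bigcup.
apply: fin_bigcup_measurable; first exact: finite_finset.
by move=> i _; have [x [y [xy ->]]] := hB i; exact: measurable_arc.
Qed.

Lemma arc_finite_union x y : adj x y ->
  finite_union_of_arcs (arc x y : set (boundary r)).
Proof.
move=> xy; exists 1%N, (fun=> arc x y); split; first by move=> _; exists x, y.
by rewrite bigcup_const //; exists ord0.
Qed.

Lemma arc_disjoint x y : adj x y ->
  arc x y `&` arc y x = set0 :> set (boundary r).
Proof.
move=> xy; rewrite -subset0 => xi [h h'].
by have [n [/= hn hn']] := filter_ex (filterI h h'); exact: subtree_disjoint xy hn hn'.
Qed.

Section NullVertices.
Variables (R : realType) (mu : probability (borelTbar r) R).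
Hypothesis mu0 : forall x, mu [set (Vertex r x : borelTbar r)] = 0%E.

Lemma vertices_null : mu (Vertex r @` setT) = 0%E.
Proof.
have [f fS] := vertices_enum r.
have e : (Vertex r @` setT : set (borelTbar r)) = \bigcup_n [set Vertex r (f n)].
  apply/seteqP; split=> z /=; last by move=> [n _ ->]; exists (f n).
  by move=> [x _ <-]; have [n <-] := fS x; exists n.
apply/negligibleP; first exact: measurable_vertices.
rewrite e; apply: negligible_bigcup => n; apply/negligibleP.
  exact: measurable_vertex.
exact: mu0.
Qed.

(** Vertices are invisible to the measure: the set on the right may be
    replaced by the boundary points that it contains. *)
Lemma mu_le_ends (S : set (borelTbar r)) (A : set (boundary r)) :
  measurable S -> measurable (@End T r @` A : set (borelTbar r)) ->
  (forall xi, S (End xi) -> A xi) -> (mu S <= mu (@End T r @` A))%E.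
Proof.
move=> mS mA SA; have mV := measurable_vertices (@setT T).
have -> : mu (@End T r @` A) = mu (@End T r @` A `|` Vertex r @` setT).
  by rewrite measureU0 //; exact: vertices_null.
apply: le_measure; rewrite ?inE //; first exact: measurableU.
by move=> [v|xi] Sz; [right; exists v|left; exists xi => //; exact: SA].
Qed.

Lemma mu_arc x y : adj x y -> mu (@End T r @` arc x y) = mu (subtree_bar x y).
Proof.
move=> xy; apply/eqP; rewrite eq_le; apply/andP; split.
  apply: le_measure; rewrite ?inE; first exact: measurable_arc.
    exact: measurable_subtree_bar.
  by move=> z; right.
apply: mu_le_ends; [exact: measurable_subtree_bar|exact: measurable_arc|].
by move=> xi [[]|[eta h [<-]]].
Qed.

End NullVertices.
End Compactification.

(** * Energy of functions with finitely supported gradient *)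

Section Energy.
Variables (T : cubicTree) (R : realType).
Implicit Types (x y : T) (F G : T -> R).

Lemma grad_seq F : fin_grad F -> exists2 s : seq (T * T), uniq s &
  forall e, e \in s <-> adj e.1 e.2 /\ F e.1 != F e.2.
Proof.
move=> /finite_seqP[s sE]; exists (undup s); first exact: undup_uniq.
move=> e; rewrite mem_undup.
have := congr1 (@^~ e) sE; rewrite /= => <-.
by rewrite normr_eq0 subr_eq0.
Qed.

Lemma fin_gradW F (s : seq (T * T)) :
  (forall a b, adj a b -> F a != F b -> (a, b) \in s) -> fin_grad F.
Proof.
move=> h; apply: (@sub_finite_set _ _ [set` s]); last exact: finite_seq.
by move=> [a b] /= [ab]; rewrite normr_eq0 subr_eq0; exact: h.
Qed.

Lemma fin_grad_le F G : fin_grad G ->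
  (forall a b, adj a b -> G a = G b -> F a = F b) -> fin_grad F.
Proof.
move=> fG h; apply: sub_finite_set fG => -[a b] /= [ab].
rewrite !normr_eq0 !subr_eq0 => Fab; split=> //.
by apply: contra Fab => /eqP e; apply/eqP; exact: h.
Qed.

Lemma energyE F (s : seq (T * T)) : uniq s ->
  (forall e, e \in s -> adj e.1 e.2) ->
  (forall a b, adj a b -> F a != F b -> (a, b) \in s) ->
  energy F = (\sum_(e <- s) (F e.1 - F e.2) ^+ 2) / 2.
Proof.
move=> us sa sF; rewrite /energy; congr (_ / 2).
rewrite (fsbigE s _ us); last 2 first.
- by move=> e /=; exact: sa.
- move=> [a b] /= ab; apply: contraNeq; rewrite real_normK ?num_real //.
  by rewrite sqrf_eq0 subr_eq0; exact: sF.
rewrite big_mkcond; apply: eq_big_seq => e /sa ea.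
by rewrite mem_set // real_normK ?num_real.
Qed.

Lemma energy_ge0 F : 0 <= energy F.
Proof.
apply: divr_ge0 => //; apply: fsumr_ge0 => e _; exact: exprn_ge0.
Qed.

Lemma common_grad (I : eqType) (t : seq I) (Fs : I -> T -> R) :
  (forall i, i \in t -> fin_grad (Fs i)) ->
  exists s : seq (T * T), [/\ uniq s, forall e, e \in s -> adj e.1 e.2 &
  forall i, i \in t -> forall a b, adj a b -> Fs i a != Fs i b -> (a, b) \in s].
Proof.
elim: t => [|i t ih] h; first by exists [::].
have [|s [us sa sF]] := ih; first by move=> j jt; apply: h; rewrite inE jt orbT.
have [s' us' s'E] := grad_seq (h i (mem_head _ _)).
exists (undup (s' ++ s)); split; first exact: undup_uniq.
  by move=> e; rewrite mem_undup mem_cat => /orP[/s'E[]|/sa].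
move=> j; rewrite inE => /orP[/eqP ->|jt] a b ab nab; rewrite mem_undup mem_cat.
  by apply/orP; left; apply/s'E.
by rewrite (sF j) ?orbT.
Qed.

(** Energies are compared edge by edge; sums on both sides serve to decompose a
    function into truncations, and a function linear along a ray into cuts. *)
Lemma energy_sum_le (I J : eqType) (t : seq I) (u : seq J)
    (Fs : I -> T -> R) (Gs : J -> T -> R) :
  (forall i, i \in t -> fin_grad (Fs i)) ->
  (forall j, j \in u -> fin_grad (Gs j)) ->
  (forall a b, adj a b -> \sum_(i <- t) (Fs i a - Fs i b) ^+ 2 <=
                          \sum_(j <- u) (Gs j a - Gs j b) ^+ 2) ->
  \sum_(i <- t) energy (Fs i) <= \sum_(j <- u) energy (Gs j).
Proof.
move=> fF fG le.
have [s1 [us1 s1a s1F]] := common_grad fF.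
have [s2 [us2 s2a s2G]] := common_grad fG.
pose s := undup (s1 ++ s2).
have sa e : e \in s -> adj e.1 e.2.
  by rewrite mem_undup mem_cat => /orP[/s1a|/s2a].
have -> : \sum_(i <- t) energy (Fs i) =
    (\sum_(e <- s) \sum_(i <- t) (Fs i e.1 - Fs i e.2) ^+ 2) / 2.
  rewrite exchange_big mulr_suml; apply: eq_big_seq => i it /=.
  rewrite (@energyE _ s) ?undup_uniq // => a b ab nab.
  by rewrite mem_undup mem_cat (s1F i).
have -> : \sum_(j <- u) energy (Gs j) =
    (\sum_(e <- s) \sum_(j <- u) (Gs j e.1 - Gs j e.2) ^+ 2) / 2.
  rewrite exchange_big mulr_suml; apply: eq_big_seq => i it /=.
  rewrite (@energyE _ s) ?undup_uniq // => a b ab nab.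
  by rewrite mem_undup mem_cat (s2G i) ?orbT.
apply: ler_wpM2r; first by rewrite invr_ge0.
rewrite big_seq_cond [leRHS]big_seq_cond; apply: ler_sum => e.
by rewrite andbT => /sa; exact: le.
Qed.

Lemma energy_le F G : fin_grad F -> fin_grad G ->
  (forall a b, adj a b -> (F a - F b) ^+ 2 <= (G a - G b) ^+ 2) ->
  energy F <= energy G.
Proof.
move=> fF fG le.
have := @energy_sum_le _ _ [:: tt] [:: tt] (fun=> F) (fun=> G).
rewrite !big_seq1; apply=> // a b ab; rewrite !big_seq1; exact: le.
Qed.

Lemma energyZ (c : R) F : fin_grad F ->
  energy (fun v => c * F v) = c ^+ 2 * energy F.
Proof.
move=> fF; have [s us sE] := grad_seq fF.
have sa e : e \in s -> adj e.1 e.2 by case/sE.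
rewrite (@energyE F s) //; last by move=> a b ab nab; apply/sE.
rewrite (@energyE _ s) //; last first.
  move=> a b ab nab; apply/sE; split=> //=.
  by apply: contra nab => /eqP ->.
rewrite mulrA mulr_sumr; congr (_ / 2); apply: eq_bigr => e _.
by rewrite -mulrBr exprMn.
Qed.

Lemma indic_subtree_edge x y : adj x y ->
  forall a b, adj a b -> (\1_(subtree x y) a : R) != \1_(subtree x y) b ->
  (a, b) \in [:: (x, y); (y, x)].
Proof.
move=> xy a b ab; rewrite !indicE.
have [/set_mem ha|/negP na] := boolP (a \in subtree x y);
  have [/set_mem hb|/negP nb] := boolP (b \in subtree x y).
- by rewrite eqxx.
- have ba : adj b a by rewrite adj_sym.
  have [-> ->] := subtree_cross xy ba (fun h => nb (mem_set h)) ha.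
  by rewrite !inE eqxx orbT.
- have [-> ->] := subtree_cross xy ab (fun h => na (mem_set h)) hb.
  by rewrite !inE eqxx.
- by rewrite eqxx.
Qed.

Lemma energy_subtree x y : adj x y -> energy (\1_(subtree x y) : T -> R) = 1.
Proof.
move=> xy.
have hy : (\1_(subtree x y) y : R) = 1.
  by rewrite indicE mem_set //; exact: subtree_root.
have hx : (\1_(subtree x y) x : R) = 0.
  by rewrite indicE memNset //; exact: subtree_avoids.
rewrite (@energyE _ [:: (x, y); (y, x)]); last exact: indic_subtree_edge.
- by rewrite !big_cons big_nil /= hx hy; field.
- rewrite /= inE xpair_eqE eq_sym andbC andbb.
  by rewrite eq_sym (negbTE (adj_neq xy)).
- by move=> e; rewrite !inE => /orP[/eqP ->|/eqP ->] //=; rewrite adj_sym.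
Qed.

(** The indicator of a subtree jumps exactly across the edge that cuts it off, so
    subtracting the jumps of [F] leaves a function without gradient. Each edge
    is listed in both directions, whence the factor one half. *)
Lemma grad_decomposition F : fin_grad F -> exists (c : R) (s : seq (T * T)),
  (forall e, e \in s -> adj e.1 e.2) /\
  forall v, F v = c + \sum_(e <- s) (F e.2 - F e.1) / 2 * \1_(subtree e.1 e.2) v.
Proof.
move=> fF; have [s us sE] := grad_seq fF.
have sa e : e \in s -> adj e.1 e.2 by case/sE.
pose S v := \sum_(e <- s) (F e.2 - F e.1) / 2 * \1_(subtree e.1 e.2) v.
have [[x0 _]|nT] := pselect (exists o : T, True); last first.
  by exists 0, [::]; split=> // v; case: nT; exists v.
exists (F x0 - S x0), s; split=> // v.
apply/eqP; rewrite -subr_eq; apply/eqP; rewrite -/(S v).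
apply: (@connected_ind T (fun v => F v - S v = F x0 - S x0) x0) => // a b ab <-.
suff e : S b - S a = F b - F a by lra.
have -> : S b - S a =
    \sum_(e <- s) (F b - F a) / 2 * ((e == (a, b))%:R + (e == (b, a))%:R).
  rewrite /S -sumrB; apply: eq_big_seq => -[x y] /sa /= xy.
  have nba : b != a by rewrite eq_sym adj_neq.
  have [[-> ->]|n1] := eqVneq (x, y) (a, b).
    rewrite xpair_eqE (eq_sym a b) (negbTE nba) /= !indicE.
    rewrite mem_set; last exact: subtree_root.
    rewrite memNset; last exact: subtree_avoids.
    by rewrite ?eqxx /= ?mulr1n ?mulr0n; ring.
  have [[-> ->]|n2] := eqVneq (x, y) (b, a).
    have ba : adj b a by rewrite adj_sym.
    rewrite !indicE [b \in _]memNset; last exact: subtree_avoids.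
    rewrite mem_set; last exact: subtree_root.
    by rewrite ?eqxx /= ?mulr1n ?mulr0n; ring.
  have -> : (\1_(subtree x y) a : R) = \1_(subtree x y) b.
    apply/eqP; apply: contraT => /(indic_subtree_edge xy ab).
    rewrite !inE !(eq_sym (a, b)) (negbTE n1) /= xpair_eqE andbC -xpair_eqE.
    by rewrite (negbTE n2).
  by rewrite subrr /= addr0 mulr0.
rewrite -mulr_sumr big_split /= -!natr_sum.
have cnt d : (\sum_(e <- s) (e == d) = (d \in s))%N.
  by rewrite -big_mkcond sum1_count count_uniq_mem.
rewrite !cnt; have [eF|nF] := eqVneq (F a) (F b); first by rewrite eF subrr !mul0r.
have -> : (a, b) \in s by apply/sE.
have -> : (b, a) \in s by apply/sE; rewrite /= adj_sym eq_sym.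
rewrite /= mulr1n; lra.
Qed.

(** The values taken at the endpoints of the edges carrying the gradient, and one
    more value, are the only ones. *)
Lemma finite_range F : fin_grad F -> exists s : seq R, forall v, F v \in s.
Proof.
move=> fF; have [s us sE] := grad_seq fF.
have [[x0 _]|nT] := pselect (exists o : T, True); last first.
  by exists [::] => v; case: nT; exists v.
exists (F x0 :: [seq F e.2 | e <- s]).
apply: (@connected_ind T _ x0); first exact: mem_head.
move=> a b ab ha; have [<- //|nF] := eqVneq (F a) (F b).
rewrite inE; apply/orP; right; apply/mapP; exists (a, b) => //.
by apply/sE.
Qed.

End Energy.

(** * Extension of functions to the boundary *)

Section Extension.
Variables (T : cubicTree) (r : T) (R : realType).
Implicit Types (x y : T) (z : borelTbar r) (F G : T -> R).

(** A ray runs through each of the finitely many edges carrying the gradient at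
    most once, so [F] is eventually constant along it. *)
Lemma extend_near F z : fin_grad F -> approach z (fun v => F v = extend F z).
Proof.
move=> fF; case: z => [x|xi] //=.
have [s us sE] := grad_seq fF; have xit := ray_trail xi.
have [N _ hN] : \forall n \near \oo, forall e, e \in s -> xi n != e.1.
  apply: (@approach_all T r _ (fun e v => v != e.1) (End xi)) => e _ /=.
  by have [N hN] := trail_leaves e.1 xit; exists N.
have cst n : (N <= n)%N -> F (xi n) = F (xi N).
  move=> /subnK <-; elim: (n - N)%N => [//|k ih]; rewrite addSn -ih.
  apply/eqP; apply: contraT => nF.
  have /(hN _ (leq_addl k N)) : (xi (k + N)%N, xi (k + N).+1) \in s.
    by apply/sE; split; [exact: xit.1|rewrite /= eq_sym].
  by rewrite eqxx.
have near_cst : \forall n \near \oo, (F \o xi) n = F (xi N).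
  by exists N => // n /= /cst.
by rewrite (lim_near_cst _ near_cst).
Qed.

Lemma extend_eq F z c : approach z (fun v => F v = c) -> extend F z = c.
Proof.
by case: z => [x|xi] //= h; apply: lim_near_cst.
Qed.

Lemma extend_comp F G (f : R -> R) z : fin_grad F ->
  (forall v, G v = f (F v)) -> extend G z = f (extend F z).
Proof.
move=> fF h; apply: extend_eq; apply: filterS (extend_near z fF) => v <-.
exact: h.
Qed.

Lemma extend_val F z : fin_grad F -> exists v, extend F z = F v.
Proof. by move=> /(extend_near z)/filter_ex[v <-]; exists v. Qed.

Lemma extend_indic x y z : adj x y ->
  extend (\1_(subtree x y) : T -> R) z = \1_(subtree_bar x y) z.
Proof.
move=> xy; apply: extend_eq; apply: filterS (approach_subtree z xy) => v h.
by rewrite !indicE; congr ((_ : bool)%:R); apply/idP/idP; rewrite !inE => /h.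
Qed.

(** By the decomposition into jumps, the extension is a finite linear combination
    of indicators of completed subtrees. *)
Lemma extend_measurable F : fin_grad F ->
  measurable_fun [set: borelTbar r] (extend F : borelTbar r -> R).
Proof.
move=> fF; have [c [s [sa sE]]] := grad_decomposition fF.
have -> : (extend F : borelTbar r -> R) = fun z =>
    c + \sum_(e <- s) (F e.2 - F e.1) / 2 *
                      (if e \in s then \1_(subtree_bar e.1 e.2) z else 0).
  apply/funext => z; apply: extend_eq.
  have h : approach z (fun v => forall e, e \in s ->
      (subtree e.1 e.2 v <-> subtree_bar e.1 e.2 z)).
    apply: (@approach_all T r _
      (fun e v => subtree e.1 e.2 v <-> subtree_bar e.1 e.2 z)) => e /sa.
    exact: approach_subtree.
  apply: filterS h => v h; rewrite sE; congr (c + _).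
  apply: eq_big_seq => e es; rewrite es; congr (_ * _).
  by rewrite !indicE; congr ((_ : bool)%:R); apply/idP/idP; rewrite !inE => /(h _ es).
apply: measurable_funD => //; apply: measurable_sum => e.
apply: measurable_funM => //; have [es|//] := boolP (e \in s).
by apply: measurable_indic; apply: measurable_subtree_bar; exact: sa.
Qed.

(** Enclose the gradient of [F] in a finite connected set of vertices. Every ray
    leaves this set for the last time through one of its finitely many exit
    edges, and beyond such an edge [F] is constant. *)
Lemma level_set_arcs F (c : R) : fin_grad F ->
  finite_union_of_arcs [set xi : boundary r | extend F (End xi) = c].
Proof.
move=> fF; have [s us sE] := grad_seq fF.
have [V [sV rV hV]] := connected_hull r [seq e.1 | e <- s].
have [nb nbE] : exists nb : T -> seq T, forall x y, adj x y = (y \in nb x).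
  by have /choice[nb nbP] := @adj_enum T; exists nb => x; have [] := nbP x.
(* V is joined to r inside V, hence without using an edge that leaves V. *)
have off x y v : x \in V -> y \notin V -> adj x y -> subtree x y v -> v \notin V.
  move=> xV yV xy hv; apply/negP => vV.
  have toV w : w \in V -> exists2 q, path (adj_without y x) r q &
      w = last r q.
    move=> /hV[q [pq eq] qV]; exists q => //.
    have : all (mem V) (r :: q) by rewrite /= rV; apply/allP.
    move=> allV; apply: sub_in_path allV pq => a b aV bV ab.
    by apply: adj_without_off => //; apply: contraNneq yV => <-.
  have [qx px ex] := toV _ xV; have [qv pv ev] := toV _ vV.
  have rx : subtree y x r.
    have := subtree_root y x; rewrite [X in subtree y x X]ex.
    elim: qx r px {ex pv ev rV toV hV} => //= a q ih b /andP[ba /ih h] /h.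
    by apply: subtree_adj; rewrite adj_without_sym.
  apply: (subtree_disjoint xy hv); rewrite ev.
  elim: qv r pv rx {ev ex px rV toV hV} => //= a q ih b /andP[ba pa] hb.
  by apply: ih => //; exact: subtree_adj hb.
have const x y v : x \in V -> y \notin V -> adj x y -> subtree x y v ->
    F v = F y.
  move=> xV yV xy [p pp ev].
  have step w : subtree x y w -> forall u, adj_without x y w u -> F u = F w.
    move=> hw u wu; apply/eqP; apply: contraT => nF.
    have : (w, u) \in s by apply/sE; case/andP: wu => -> _; rewrite eq_sym.
    move=> /(map_f fst)/sV /= wV; have := off _ _ _ xV yV xy hw.
    by rewrite wV.
  have along q w : path (adj_without x y) w q -> subtree x y w ->
      F (last w q) = F w.
    elim: q w => //= a q ih w /andP[wa qa] hw.
    rewrite (ih a qa); first exact: step hw _ wa.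
    exact: subtree_adj hw.
  by rewrite ev; apply: along pp _; exact: subtree_root.
pose L := [seq e <- [seq (x, y) | x <- V, y <- nb x] |
             (e.2 \notin V) && (F e.2 == c)].
have LE x y : (x, y) \in L <-> [/\ x \in V, adj x y, y \notin V & F y = c].
  rewrite mem_filter /=; split.
    move=> /andP[/andP[yV /eqP Fy] /allpairsPdep[a [b [aV ba [ex ey]]]]].
    by rewrite ex ey in yV Fy *; split=> //; rewrite nbE.
  move=> [xV xy -> ->]; rewrite eqxx /=; apply/allpairsPdep.
  by exists x, y; rewrite -nbE.
exists (size L), (fun i => let e := nth (r, r) L i in arc e.1 e.2); split.
  move=> i; have := mem_nth (r, r) (ltn_ord i).
  by case: (nth _ _ _) => x y /LE[_ xy _ _]; exists x, y.
apply/seteqP; split=> [xi /= xic|xi [i _]]; last first.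
  have := mem_nth (r, r) (ltn_ord i).
  case: (nth _ _ _) => x y /LE[xV xy yV Fy] /= hxi.
  have h : approach (End xi) (subtree x y) by [].
  suff : extend F (End xi) = c by [].
  by apply: extend_eq; apply: filterS h => v hv; rewrite (const x y).
have [N _ hN] : \forall n \near \oo, forall x, x \in V -> xi n != x.
  apply: (@approach_all T r _ (fun x v => v != x) (End xi)) => x _ /=.
  by have [N hN] := trail_leaves x (ray_trail xi); exists N.
(* The last visit of the ray to V singles out the edge. *)
have ex0 : exists n, xi n \in V by exists 0%N; rewrite ray0.
have bd n : xi n \in V -> (n <= N)%N.
  move=> nV; rewrite leqNgt; apply/negP => /ltnW /hN /(_ _ nV).
  by rewrite eqxx.
case: (ex_maxnP ex0 bd) => n nV nmax.
have n1V : xi n.+1 \notin V by apply/negP => /nmax; rewrite ltnn.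
have xa := (ray_trail xi).1 n.
have tail : arc (xi n) (xi n.+1) xi.
  by exists n.+1 => // m; exact: trail_tail (ray_trail xi).
have nL : (xi n, xi n.+1) \in L.
  apply/LE; split=> //.
  have <- : extend F (End xi) = c by [].
  apply/esym; apply: extend_eq.
  have h : approach (End xi) (subtree (xi n) (xi n.+1)) by [].
  by apply: filterS h => v hv; rewrite (const (xi n) (xi n.+1)).
have iL : (index (xi n, xi n.+1) L < size L)%N by rewrite index_mem.
by exists (Ordinal iL) => //=; rewrite nth_index.
Qed.

End Extension.

(** * Condensers, the Poincare inequality and the Carleson inequality *)

Section Constants.
Variables (T : cubicTree) (r : T) (R : realType).
Variable mu : probability (borelTbar r) R.
Implicit Types (x y o : T) (F G : T -> R) (A B : set (boundary r)).

Definition mass (S : set (borelTbar r)) : R := fine (mu S).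

Lemma massE S : measurable S -> mu S = (mass S)%:E.
Proof. by move=> mS; rewrite /mass fineK // fin_num_measure. Qed.

Lemma mass_ge0 S : 0 <= mass S.
Proof. exact: fine_ge0. Qed.

Lemma mass_setC S : measurable S -> mass (~` S) = 1 - mass S.
Proof.
move=> mS; apply: EFin_inj; rewrite -massE; last exact: measurableC.
by rewrite probability_setC // massE // EFinB.
Qed.

Lemma massU_le S S' : measurable S -> measurable S' ->
  mass (S `|` S') <= mass S + mass S'.
Proof.
move=> mS mS'; rewrite -lee_fin EFinD -!massE //; last exact: measurableU.
exact: measureU2.
Qed.

Lemma massT : mass setT = 1.
Proof. by rewrite /mass probability_setT. Qed.

(** The capacity bound with its quotient and its infimum unfolded, so that no
    extended arithmetic is left. Empty plates are allowed, as they have mass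
    zero. *)
Definition cap_bound (M : R) := forall A B F,
  finite_union_of_arcs A -> finite_union_of_arcs B -> A `&` B = set0 ->
  fin_grad F -> (forall xi, A xi -> extend F (End xi) = 1) ->
  (forall xi, B xi -> extend F (End xi) = 0) ->
  mass (@End T r @` A) * mass (@End T r @` B) <= M * energy F.

Lemma capacity_le A B F : fin_grad F ->
  (forall xi, A xi -> extend F (End xi) = 1) ->
  (forall xi, B xi -> extend F (End xi) = 0) ->
  (capacity R A B <= (energy F)%:E)%E.
Proof. by move=> fF hA hB; apply: ereal_inf_lbound; exists F. Qed.

Lemma capacity_ge0 A B : (0 <= capacity R A B)%E.
Proof.
by apply: le_ereal_inf_tmp => _ [F _ <-]; rewrite lee_fin energy_ge0.
Qed.

(** The case of capacity zero needs care: the quotient is then infinite unless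
    the product of the masses vanishes. *)
Lemma capacity_const_cap_bound M : 0 <= M ->
  (capacity_const mu <= M%:E)%E -> cap_bound M.
Proof.
move=> M0 cM A B F fA fB AB fF F1 F0.
have mA := measurable_arcs fA; have mB := measurable_arcs fB.
have ME : 0 <= M * energy F by rewrite mulr_ge0 // energy_ge0.
have [A0|/set0P nA] := eqVneq A set0.
  by rewrite A0 image_set0 /mass measure0 mul0r.
have [B0|/set0P nB] := eqVneq B set0.
  by rewrite B0 image_set0 /mass measure0 mulr0.
have : (mu (@End T r @` A) * mu (@End T r @` B) / capacity R A B <= M%:E)%E.
  by apply: le_trans cM; apply: ereal_sup_ubound; exists A, B.
rewrite !massE // -EFinM; set a := _ * _.
have a0 : 0 <= a by rewrite mulr_ge0 // mass_ge0.
have := capacity_le fF F1 F0; have := capacity_ge0 A B.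
case: (capacity R A B) => [k| |] //; rewrite !lee_fin => k0 kE.
rewrite inver; case: eqVneq => [_|kn].
  move: a0; rewrite le_eqVlt => /orP[/eqP <- //|ap].
  by rewrite gt0_muley ?lte_fin // leye_eq.
rewrite -EFinM lee_fin ler_pdivrMr ?lt_neqAle 1?eq_sym ?kn // => h.
by apply: (le_trans h); exact: ler_wpM2l.
Qed.

Lemma cap_bound_capacity_const M : 0 <= M -> cap_bound M ->
  (capacity_const mu <= M%:E)%E.
Proof.
move=> M0 h; apply: ge_ereal_sup => _ [A [B [[fA fB _ _ AB] ->]]].
have mA := measurable_arcs fA; have mB := measurable_arcs fB.
suff : (mu (@End T r @` A) * mu (@End T r @` B) / capacity R A B <= M%:E)%E by [].
rewrite !massE // -EFinM; set a := _ * _.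
have a0 : 0 <= a by rewrite mulr_ge0 // mass_ge0.
have aF F : fin_grad F -> (forall xi, A xi -> extend F (End xi) = 1) ->
  (forall xi, B xi -> extend F (End xi) = 0) -> a <= M * energy F by exact: h.
have [a_eq0|an] := eqVneq a 0; first by rewrite a_eq0 mul0e lee_fin.
have ap : 0 < a by rewrite lt_def an.
have [[F [fF F1 F0]]|nF] := pselect (exists F, [/\ fin_grad F,
    forall xi, A xi -> extend F (End xi) = 1 &
    forall xi, B xi -> extend F (End xi) = 0]); last first.
  have -> : capacity R A B = +oo%E.
    rewrite /capacity (_ : [set _ | F in _] = set0) ?ereal_inf0 //.
    by rewrite -subset0 => e [F hF _]; apply: nF; exists F.
  by rewrite invey mule0 lee_fin.
have Mp : 0 < M.
  rewrite lt_def M0 andbT; apply: contraTneq ap => Mz.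
  by rewrite -leNgt; have := aF F fF F1 F0; rewrite Mz mul0r.
have : ((a / M)%:E <= capacity R A B)%E.
  apply: le_ereal_inf_tmp => _ [G [fG G1 G0] <-].
  by rewrite lee_fin ler_pdivrMr // mulrC; exact: aF.
have := capacity_le fF F1 F0; case: (capacity R A B) => [k| |] // _.
rewrite lee_fin ler_pdivrMr // => ak.
have kp : 0 < k.
  by rewrite -(pmulr_lgt0 _ Mp); exact: lt_le_trans ak.
by rewrite inver gt_eqF // -EFinM lee_fin ler_pdivrMr // mulrC.
Qed.

Lemma integral_layers (I : Type) (t : seq I) (c : I -> R)
    (S : I -> set (borelTbar r)) :
  (forall i, 0 <= c i) -> (forall i, measurable (S i)) ->
  (\int[mu]_z (\sum_(i <- t) c i * \1_(S i) z)%:E =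
   (\sum_(i <- t) c i * mass (S i))%:E)%E.
Proof.
move=> c0 mS.
have ms (t' : seq I) : measurable_fun [set: borelTbar r]
    (fun z => \sum_(i <- t') c i * \1_(S i) z).
  by apply: measurable_sum => i; apply: measurable_funM => //; exact: measurable_indic.
have s0 (t' : seq I) (z : borelTbar r) : 0 <= \sum_(i <- t') c i * \1_(S i) z.
  by apply: sumr_ge0 => i _; rewrite mulr_ge0 // indicE.
elim: t => [|i t ih].
  by rewrite big_nil; under eq_integral do rewrite big_nil; exact: integral0.
under eq_integral do rewrite big_cons EFinD.
have mi : measurable_fun [set: borelTbar r] (fun z => c i * \1_(S i) z).
  by apply: measurable_funM => //; exact: measurable_indic.
rewrite ge0_integralD //; last 4 first.
- by move=> z _; rewrite lee_fin mulr_ge0 // indicE.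
- exact/measurable_EFinP.
- by move=> z _; rewrite lee_fin.
- exact/measurable_EFinP.
rewrite ih big_cons EFinD; congr (_ + _)%E.
under eq_integral do rewrite EFinM.
rewrite ge0_integralZl_EFin //; last first.
  by apply/measurable_EFinP; exact: measurable_indic.
rewrite EFinM -massE //; congr (_ * _)%E.
by rewrite integral_indic // setIT.
Qed.

Lemma extend_bounded F : fin_grad F ->
  exists K : R, forall z : borelTbar r, `|extend F z| <= K.
Proof.
move=> fF; have [s hs] := finite_range fF.
exists (\sum_(c <- s) `|c|) => z; have [v ->] := extend_val z fF.
by rewrite (big_rem (F v)) //= lerDl sumr_ge0.
Qed.

Lemma integrable_bounded (f : borelTbar r -> R) (K : R) :
  measurable_fun setT f -> (forall z, `|f z| <= K) ->
  mu.-integrable setT (EFin \o f).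
Proof.
move=> mf fK; apply: measurable_bounded_integrable => //.
  by rewrite (le_lt_trans (probability_le1 _ _)) ?ltry.
exists K; split; first exact: num_real.
by move=> L KL z _ /=; exact: le_trans (fK z) (ltW KL).
Qed.

(** Replacing the mean by [a] adds the square of their difference to the
    integral. *)
Lemma variance_le F (a : R) : fin_grad F ->
  (\int[mu]_z (`|extend F z - mean mu F| ^+ 2)%:E <=
   \int[mu]_z (`|extend F z - a| ^+ 2)%:E)%E.
Proof.
move=> fF; have mF := extend_measurable (r := r) fF.
have [K hK] := extend_bounded fF.
pose m := mean mu F.
have iF := integrable_bounded mF hK.
have isq (b : R) : mu.-integrable setT
    (EFin \o (fun z : borelTbar r => `|extend F z - b| ^+ 2)).
  apply: (@integrable_bounded _ ((K + `|b|) ^+ 2)).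
    apply: (measurable_funX 2).
    by apply: measurableT_comp => //; exact: measurable_funB.
  move=> z; rewrite normrX normr_id ler_sqr ?nnegrE //.
    by rewrite (le_trans (ler_normB _ _)) // lerD2r.
  by rewrite addr_ge0 // (le_trans _ (hK z)).
have fin (b : R) := integrable_fin_num measurableT (isq b).
rewrite -(fineK (fin m)) -(fineK (fin a)) lee_fin.
rewrite -!/(Rintegral _ _ _) -/m.
have icst (c : R) : mu.-integrable setT (EFin \o (fun=> c : R)).
  exact: (@integrable_bounded _ `|c|).
have iZ : mu.-integrable setT
    (EFin \o (fun z : borelTbar r => 2 * (m - a) * extend F z)).
  apply: (@integrable_bounded _ (`|2 * (m - a)| * K)).
    exact: measurable_funM.
  by move=> z; rewrite normrM ler_wpM2l.
have iG : mu.-integrable setT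
    (EFin \o (fun z : borelTbar r => 2 * (m - a) * extend F z + (a ^+ 2 - m ^+ 2))).
  apply: (@integrable_bounded _ (`|2 * (m - a)| * K + `|a ^+ 2 - m ^+ 2|)).
    by apply: measurable_funD => //; exact: measurable_funM.
  move=> z; rewrite (le_trans (ler_normD _ _)) // lerD2r.
  by rewrite normrM ler_wpM2l.
have -> : \int[mu]_z (`|extend F z - a| ^+ 2) =
    \int[mu]_z (`|extend F z - m| ^+ 2 +
      (2 * (m - a) * extend F z + (a ^+ 2 - m ^+ 2))).
  by apply: eq_Rintegral => z _; rewrite !real_normK ?num_real //; ring.
rewrite (RintegralD measurableT (isq m) iG) (RintegralD measurableT iZ (icst _)).
rewrite (RintegralZl _ measurableT iF) Rintegral_cst // -/(mean mu F) -/m.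
rewrite [fine _](_ : _ = 1); last exact: massT.
rewrite lerDl [leRHS](_ : _ = (m - a) ^+ 2); last by ring.
exact: sqr_ge0.
Qed.

(** With [m] the mean of a competitor of the condenser, its variance is at least
    [a (1 - m)^2 + b m^2], where [a] and [b] are the masses of the plates. As
    [a + b <= 1], this is at least [a b], the minimum over [m] of its product
    with [a + b]. *)
Lemma poincare_set_cap_bound (K : R) : 0 <= K ->
  (forall F, fin_grad F ->
      (\int[mu]_z (`|extend F z - mean mu F| ^+ 2)%:E
        <= (K * energy F)%:E)%E) ->
  cap_bound K.
Proof.
move=> K0 h A B F fA fB AB fF F1 F0; rewrite -lee_fin.
apply: le_trans (h F fF).
have mA := measurable_arcs fA; have mB := measurable_arcs fB.
set m := mean mu F; pose a := mass (@End T r @` A); pose b := mass (@End T r @` B).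
have a0 : 0 <= a by exact: mass_ge0.
have b0 : 0 <= b by exact: mass_ge0.
have disj : @End T r @` A `&` @End T r @` B = set0 :> set (borelTbar r).
  rewrite -subset0 => z [[xi Axi <-] [eta Beta [e]]].
  have : (A `&` B) xi by split=> //; rewrite -e.
  by rewrite AB.
have ab1 : a + b <= 1.
  rewrite -massT -lee_fin EFinD -!massE // -measureU //.
  by apply: le_measure; rewrite ?inE //; exact: measurableU.
pose c (i : bool) : R := if i then (1 - m) ^+ 2 else m ^+ 2.
pose S (i : bool) : set (borelTbar r) :=
  if i then @End T r @` A else @End T r @` B.
apply: (@le_trans _ _ (\int[mu]_z (\sum_(i <- [:: true; false]) c i * \1_(S i) z)%:E)%E).
  rewrite integral_layers; last 2 first.
  - by case; exact: sqr_ge0.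
  - by case.
  rewrite lee_fin !big_cons big_nil addr0 /= -/a -/b.
  set q := (1 - m) ^+ 2 * a + m ^+ 2 * b.
  have q0 : 0 <= q by rewrite addr_ge0 // mulr_ge0 // sqr_ge0.
  apply: (@le_trans _ _ ((a + b) * q)); last exact: ler_piMl.
  rewrite -subr_ge0 (_ : _ - _ = (a * (1 - m) - b * m) ^+ 2) ?sqr_ge0 //.
  by rewrite /q; ring.
apply: ge0_le_integral => //.
- move=> z _; rewrite lee_fin; apply: sumr_ge0 => i _.
  by rewrite mulr_ge0 // ?indicE //; case: i; exact: sqr_ge0.
- apply/measurable_EFinP; apply: measurable_sum => i; apply: measurable_funM => //.
  by apply: measurable_indic; case: i.
- apply/measurable_EFinP; apply: (measurable_funX 2).
  apply: measurableT_comp => //; apply: measurable_funB => //.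
  exact: extend_measurable.
move=> z _; rewrite lee_fin !big_cons big_nil addr0 /= real_normK ?num_real //.
rewrite !indicE.
have [/set_mem zA|nA] := boolP (z \in _ @` A);
  have [/set_mem zB|nB] := boolP (z \in _ @` B).
- by exfalso; rewrite -[False]/(set0 z) -disj.
- case: zA => xi Axi <-; rewrite F1 // mulr0 addr0 mulr1.
  by [].
- case: zB => xi Bxi <-; rewrite F0 // mulr0 add0r mulr1 sub0r sqrrN.
  by [].
- by rewrite !mulr0 addr0 sqr_ge0.
Qed.

(** Apply the inequality at [o] to [F - F o]: the mean is a better constant than
    [F o]. *)
Lemma carleson_set_poincare_set o (K : R) : 0 <= K ->
  (forall F, fin_grad F ->
      (\int[mu]_z (`|extend F z| ^+ 2)%:E
        <= (K * (`|F o| ^+ 2 + energy F))%:E)%E) ->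
  forall F, fin_grad F ->
      (\int[mu]_z (`|extend F z - mean mu F| ^+ 2)%:E
        <= (K * energy F)%:E)%E.
Proof.
move=> K0 h F fF; apply: le_trans (variance_le (F o) fF) _.
pose G v := F v - F o.
have fG : fin_grad G by apply: fin_grad_le fF _ => a b _; rewrite /G => ->.
have eG z : extend G z = extend F z - F o.
  by apply: (@extend_comp _ _ _ F G (fun t => t - F o)).
have EG : energy G <= energy F.
  by apply: energy_le => // a b _; rewrite /G opprB addrA subrK.
under eq_integral do rewrite -eG.
apply: le_trans (h G fG) _; rewrite lee_fin ler_wpM2l //.
by rewrite /G subrr normr0 expr0n add0r.
Qed.

End Constants.

(** * A center of the measure *)

Section Center.
Variables (T : cubicTree) (r : T) (R : realType).
Variable mu : probability (borelTbar r) R.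
Hypothesis mu0 : forall x, mu [set (Vertex r x : borelTbar r)] = 0%E.
Implicit Types (x y o : T).

Notation mass := (mass mu).
Notation branch x y := (subtree_bar x y : set (borelTbar r)).

Lemma massC x y : adj x y -> mass (branch y x) = 1 - mass (branch x y).
Proof.
move=> xy; rewrite -mass_setC; last exact: measurable_subtree_bar.
by rewrite (subtree_barC _ xy).
Qed.

Lemma mass_arc x y : adj x y ->
  mass (@End T r @` arc x y) = mass (branch x y).
Proof. by move=> xy; rewrite /mass mu_arc. Qed.

(** A function that grows linearly from 0 to 1 along a ray has energy inversely
    proportional to the number of edges used, since each edge of the tree
    contributes to at most one of the nested cuts. *)
Lemma ray_capacity (xi : boundary r) m N : (0 < N)%N ->
  exists F : T -> R, [/\ fin_grad F, energy F <= N%:R^-1,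
    forall eta : boundary r,
      arc (xi (m + N)%N) (xi (m + N).+1) eta -> extend F (End eta) = 1 &
    forall eta : boundary r,
      arc (xi m.+1) (xi m) eta -> extend F (End eta) = 0].
Proof.
move=> N0; have xit := ray_trail xi; have xa := xit.1.
have xb n : xi n != xi n.+2.
  by apply/eqP => /xit.2 e; have := ltnSn n; rewrite -[X in (_ < X)%N]/(n.+1) {1}e ltnNge ltnW.
pose c k : T -> R := \1_(subtree (xi k) (xi k.+1)).
pose h n v := \sum_(k <- iota m n) c k v.
have fc k : fin_grad (c k) by apply: fin_gradW; exact: indic_subtree_edge.
have hS n v : h n.+1 v = h n v + c (m + n)%N v.
  by rewrite /h iotaSr big_cat /= big_seq1.
have full n v : (forall k, (k < m + n)%N -> subtree (xi k) (xi k.+1) v) ->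
    h n v = n%:R.
  move=> hv; rewrite /h (eq_big_seq (fun=> 1)) => [|j].
    by rewrite big_const_seq count_predT size_iota iter_addr_0.
  by rewrite mem_iota => /andP[_ jn]; rewrite /c indicE mem_set //; exact: hv.
have on_ray n j : (m + n <= j)%N -> h n (xi j) = n%:R.
  move=> nj; apply: full => k kn; apply: trail_tail => //.
  exact: leq_trans kn nj.
have grad n a b : adj a b -> (h n a - h n b) ^+ 2 <=
    \sum_(k <- iota m n) (c k a - c k b) ^+ 2.
  move=> ab; elim: n => [|n ih]; first by rewrite /h /= !big_nil subrr expr0n.
  have s0 : 0 <= \sum_(k <- iota m n) (c k a - c k b) ^+ 2.
    by apply: sumr_ge0 => k _; exact: sqr_ge0.
  rewrite iotaSr big_cat /= big_seq1 !hS.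
  have [ec|nc] := eqVneq (c (m + n)%N a) (c (m + n)%N b).
    by rewrite ec subrr expr0n /= addr0 opprD addrACA subrr addr0.
  suff -> : h n a = h n b by rewrite opprD addrACA subrr add0r lerDr.
  have := indic_subtree_edge (xa (m + n)%N) ab nc.
  by rewrite !inE => /orP[] /eqP[-> ->]; rewrite !on_ray // leqW.
have fh : fin_grad (h N).
  have [s [_ _ sF]] := common_grad (t := iota m N) (Fs := c) (fun k _ => fc k).
  apply: (@fin_gradW _ _ _ s) => a b ab; apply: contraNT => nab; apply/eqP.
  apply: eq_big_seq => k kN; apply/eqP; apply: contraNT nab => nc.
  exact: sF kN _ _ ab nc.
have eh : energy (h N) <= N%:R.
  have := @energy_sum_le T R _ _ [:: tt] (iota m N) (fun=> h N) c.
  rewrite big_seq1; have -> : \sum_(k <- iota m N) energy (c k) = N%:R.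
    rewrite (eq_bigr (fun=> 1)) => [|k _]; last exact: energy_subtree.
    by rewrite big_const_seq count_predT size_iota iter_addr_0.
  by apply=> // a b ab; rewrite big_seq1; exact: grad.
have NR : (0 : R) < N%:R by rewrite ltr0n.
exists (fun v => N%:R^-1 * h N v); split.
- by apply: fin_grad_le fh _ => a b _ ->.
- rewrite energyZ // expr2 -mulrA ler_piMr ?invr_ge0 ?(ltW NR) //.
  by rewrite ler_pdivrMl // mulr1.
- move=> eta heta; apply: extend_eq.
  have hn : approach (End eta) (subtree (xi (m + N)%N) (xi (m + N).+1)) by [].
  apply: filterS hn => v hv; rewrite full ?mulVf ?gt_eqF // => k kN.
  by apply: (nonbacktracking_nested xa xb (ltnW kN)).
- move=> eta heta; apply: extend_eq.
  have hn : approach (End eta) (subtree (xi m.+1) (xi m)) by [].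
  apply: filterS hn => v hv; rewrite /h big1_seq ?mulr0 // => k /andP[_].
  rewrite mem_iota => /andP[mk _]; rewrite /c indicE memNset // => hv'.
  apply: (subtree_disjoint (xa m) _ hv).
  exact: (nonbacktracking_nested xa xb mk).
Qed.

Variable M : R.
Hypothesis M0 : 0 <= M.
Hypothesis hM : cap_bound mu M.

(** If all branches along a ray are heavy, condensers between a far branch of
    the ray and a fixed side branch have small capacity, so that the side
    branch is null and the measure sits at the end of the ray. *)
Lemma heavy_ray_dirac (xi : boundary r) :
  (forall n, 2^-1 < mass (branch (xi n) (xi n.+1))) -> is_boundary_dirac mu.
Proof.
move=> heavy; have xit := ray_trail xi; have xa := xit.1.
have xa' n : adj (xi n.+1) (xi n) by rewrite adj_sym.
have side m : mass (branch (xi m.+1) (xi m)) = 0.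
  apply/eqP; rewrite eq_le mass_ge0 andbT leNgt; apply/negP.
  set b := mass _ => b0.
  (* So many edges that the capacity bound M / N is below b / 2. *)
  pose N := (Num.truncn (2 * M / b)).+1.
  have [F [fF EF F1 F0]] := ray_capacity xi m (ltn0Sn _ : (0 < N)%N).
  have dis : arc (xi (m + N)%N) (xi (m + N).+1) `&` arc (xi m.+1) (xi m)
      = set0 :> set (boundary r).
    rewrite -subset0 => eta [h1 h0]; have := F1 _ h1; rewrite F0 //.
    by move/eqP; rewrite eq_sym oner_eq0.
  have := hM (arc_finite_union r (xa _)) (arc_finite_union r (xa' _)) dis fF F1 F0.
  rewrite !mass_arc // -/b; apply/negP; rewrite -ltNge.
  apply: (@le_lt_trans _ _ (M * N%:R^-1)); first exact: ler_wpM2l.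
  apply: (@lt_trans _ _ (2^-1 * b)); last by rewrite ltr_pM2r.
  rewrite ltr_pdivrMr ?ltr0n // -mulrA ltr_pdivlMl //.
  by rewrite [b * _]mulrC -ltr_pdivrMr // truncnS_gt.
have mb m : measurable (branch (xi m.+1) (xi m)) by exact: measurable_subtree_bar.
have side0 m : mu (branch (xi m.+1) (xi m)) = 0%E by rewrite massE // side.
(* W is null and contains everything but the end of the ray. *)
pose W : set (borelTbar r) :=
  (\bigcup_m branch (xi m.+1) (xi m)) `|` (Vertex r @` setT).
have mW : measurable W.
  by apply: measurableU; [exact: bigcupT_measurable|exact: measurable_vertices].
have W0 : mu W = 0%E.
  apply/negligibleP => //; apply: negligibleU.
    apply: negligible_bigcup => m; apply/negligibleP => //.
    exact: side0.
  by apply/negligibleP; [exact: measurable_vertices|exact: vertices_null].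
have notW z : z != End xi -> W z.
  move=> nz; apply: contrapT => nW; move/eqP: nz; apply.
  case: z nW => [v|eta] nW; first by case: nW; right; exists v.
  have h m : arc (xi m) (xi m.+1) eta.
    case: (approach_side (xi m) (xi m.+1) (End eta)) => // h.
    by case: nW; left; exists m => //; apply/subtree_barE.
  congr End; apply/esym; apply: boundary_eq; elim=> [|m ih].
    by rewrite !ray0.
  exact: arc_step.
exists xi => S mS; rewrite diracE.
have [/set_mem xiS|/negP xiS] := boolP (End xi \in S).
  have e0 : mu (~` S) = 0%E.
    apply: (subset_measure0 (measurableC mS) mW) => // z nSz; apply: notW.
    by apply/eqP => ez; apply: nSz; rewrite ez.
  have : mass (~` S) = 0 by rewrite /mass e0.
  by rewrite mass_setC // => /subr0_eq e1; apply: etrans (massE mu mS) _; rewrite -e1.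
apply: (subset_measure0 mS mW) => // z Sz; apply: notW.
by apply/eqP => ez; apply: xiS; rewrite inE -ez.
Qed.

(** Following heavy branches never backtracks, as the two sides of an edge
    cannot both be heavy; without a center this would produce a heavy ray. *)
Lemma exists_center : ~ is_boundary_dirac mu ->
  exists o : T, forall y, adj o y -> mass (branch o y) <= 2^-1.
Proof.
move=> nd; apply: contrapT => nc; apply: nd.
have /choice[f hf] (x : T) : exists y, adj x y /\ 2^-1 < mass (branch x y).
  apply: contrapT => nx; apply: nc; exists x => y xy; rewrite leNgt.
  by apply/negP => h; apply: nx; exists y.
pose g n := iter n f r.
have ga n : adj (g n) (g n.+1) by exact: (hf _).1.
have gb n : g n != g n.+2.
  apply/eqP => e; have h1 := (hf (g n)).2; have h2 := (hf (g n.+1)).2.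
  have := massC (ga n); rewrite -[f (g n.+1)]/(g n.+2) -e in h2 *.
  rewrite -[f (g n)]/(g n.+1) in h1 *; lra.
have gg := nonbacktracking_geodesic ga gb.
apply: (@heavy_ray_dirac (@Ray T r g erefl gg)) => n.
exact: (hf _).2.
Qed.

(** One branch at the center carries at least a third of the mass, and its
    complement at least a half. *)
Lemma center_lower_bound o : (forall y, adj o y -> mass (branch o y) <= 2^-1) ->
  6^-1 <= M.
Proof.
move=> ho; have [s [ss sE]] := adj_enum o.
have [y ys third] : exists2 y, y \in s & 3^-1 <= mass (branch o y).
  apply: contrapT => nh.
  have light y : y \in s -> mass (branch o y) < 3^-1.
    by move=> ys; rewrite ltNge; apply/negP => h; apply: nh; exists y.
  case: s ss sE nh light => [|y1 [|y2 [|y3 [|]]]] // _ sE _ light.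
  have m1 : measurable (branch o y1) by apply: measurable_subtree_bar; rewrite sE !inE eqxx.
  have m2 : measurable (branch o y2).
    by apply: measurable_subtree_bar; rewrite sE !inE eqxx orbT.
  have m3 : measurable (branch o y3).
    by apply: measurable_subtree_bar; rewrite sE !inE eqxx !orbT.
  have l1 : mass (branch o y1) < 3^-1 by apply: light; rewrite !inE eqxx.
  have l2 : mass (branch o y2) < 3^-1 by apply: light; rewrite !inE eqxx orbT.
  have l3 : mass (branch o y3) < 3^-1 by apply: light; rewrite !inE eqxx !orbT.
  have m0 := measurable_vertex (r := r) o.
  have e0 : mass [set Vertex r o] = 0 by rewrite /mass mu0.
  have := massT mu; have -> : [set: borelTbar r] =
      [set Vertex r o] `|` (branch o y1 `|` (branch o y2 `|` branch o y3)).
    apply/seteqP; split=> // z _.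
    case: (bar_branch_cover o z) => [->|[y oy h]]; first by left.
    right; rewrite sE !inE in oy.
    case/or3P: oy => /eqP e; rewrite e in h; [by left|right; by left|right; by right].
  have m23 := measurableU _ _ m2 m3; have m123 := measurableU _ _ m1 m23.
  have u1 := massU_le mu m0 m123; have u2 := massU_le mu m1 m23.
  have u3 := massU_le mu m2 m3; lra.
have oy : adj o y by rewrite sE.
have yo : adj y o by rewrite adj_sym.
have fI : fin_grad (\1_(subtree o y) : T -> R).
  by apply: fin_gradW; exact: indic_subtree_edge.
have := hM (arc_finite_union r oy) (arc_finite_union r yo) (arc_disjoint r oy) fI.
rewrite !mass_arc // (massC oy) energy_subtree // mulr1 => h.
have {h} : mass (branch o y) * (1 - mass (branch o y)) <= M.
  apply: h => xi hxi; rewrite extend_indic // indicE.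
    by rewrite mem_set //; apply/subtree_barE.
  rewrite memNset // => /subtree_barE h'.
  have : approach (End xi) (subtree y o) by [].
  move=> /(filterI h')/filter_ex[v [v1 v2]]; exact: subtree_disjoint oy v1 v2.
by have := ho y oy; nra.
Qed.

End Center.

(** * Dyadic slicing of a nonnegative number *)

Section DyadicLevels.
Variable R : realType.
Implicit Types (x y a b : R) (n : nat).

Definition slice a b x := Num.min x b - Num.min x a.

Lemma slice_nondecreasing a b x y : a <= b -> x <= y ->
  slice a b x <= slice a b y.
Proof.
by rewrite /slice /Num.min => ab xy; do 4! case: ltP => ?; lra.
Qed.

(** Slices at increasing levels are all monotone, so their increments have the
    same sign and the squares of these add up to at most the square of their
    sum. *)
Lemma slice_sum_sqr (b : nat -> R) n x y : (forall k, b k <= b k.+1) ->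
  \sum_(k <- iota 0 n) (slice (b k) (b k.+1) x - slice (b k) (b k.+1) y) ^+ 2
    <= (x - y) ^+ 2.
Proof.
move=> bS; wlog yx : x y / y <= x => [hw|].
  have [|/ltW xy] := leP y x; first exact: hw.
  rewrite -[leRHS]sqrrN opprB; apply: le_trans (hw _ _ xy).
  by apply: ler_sum => k _; rewrite -[leLHS]sqrrN opprB.
pose d k := slice (b k) (b k.+1) x - slice (b k) (b k.+1) y.
have d0 k : 0 <= d k by rewrite subr_ge0; exact: slice_nondecreasing.
have b0 k : b 0%N <= b k by elim: k => // k ih; exact: le_trans (bS k).
have sum_d k : \sum_(j <- iota 0 k) d j = slice (b 0%N) (b k) x - slice (b 0%N) (b k) y.
  elim: k => [|k ih]; first by rewrite /= big_nil /slice !subrr.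
  by rewrite iotaSr big_cat /= big_seq1 add0n ih /d /slice; ring.
have sq k : \sum_(j <- iota 0 k) d j ^+ 2 <= (\sum_(j <- iota 0 k) d j) ^+ 2.
  elim: k => [|k ih]; first by rewrite /= !big_nil expr0n.
  rewrite iotaSr !big_cat /= !big_seq1; set s := \sum_(j <- _) _ in ih *.
  have s0 : 0 <= \sum_(j <- iota 0 k) d j by exact: sumr_ge0.
  have := d0 (0 + k)%N; nra.
apply: le_trans (sq n) _; rewrite sum_d.
have := b0 n; move: (b 0%N) (b n) => a c ac.
have h0 := slice_nondecreasing ac yx.
rewrite ler_sqr ?nnegrE ?subr_ge0 //.
by move: ac yx {h0}; rewrite /slice /Num.min => ac yx; do 4! case: ltP => ?; lra.
Qed.

(** The largest dyadic level below [t] exceeds [t / 2]. *)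
Lemma sqr_le_dyadic a t n : 0 < a -> (t = 0 \/ a <= t) -> t < a * 2 ^+ n ->
  t ^+ 2 <= \sum_(k <- iota 0 n) 4 * (a * 2 ^+ k) ^+ 2 * (a * 2 ^+ k <= t)%R%:R.
Proof.
move=> a0 ht; elim: n => [|n ih] tn.
  rewrite /= big_nil; case: ht => [->|h]; first by rewrite expr0n.
  by move: tn; rewrite expr0 mulr1 ltNge h.
have p0 : 0 < a * 2 ^+ n by rewrite mulr_gt0 // exprn_gt0.
rewrite iotaSr big_cat /= big_seq1 add0n.
have s0 : 0 <= \sum_(k <- iota 0 n) 4 * (a * 2 ^+ k) ^+ 2 * (a * 2 ^+ k <= t)%R%:R.
  by apply: sumr_ge0 => k _; rewrite mulr_ge0 // mulr_ge0 // sqr_ge0.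
have [h|h] := leP (a * 2 ^+ n) t; last by rewrite mulr0 addr0; exact: ih.
rewrite mulr1; move: tn; rewrite exprS => tn; nra.
Qed.

Lemma finite_levels (s : seq R) : exists (a : R) n, 0 < a /\
  forall x, x \in s -> (`|x| = 0 \/ a <= `|x|) /\ `|x| < a * 2 ^+ n.
Proof.
have [a [a0 ha]] : exists a : R, 0 < a /\ forall x, x \in s -> `|x| = 0 \/ a <= `|x|.
  elim: s => [|x s [a [a0 ha]]]; first by exists 1.
  have [->|x0] := eqVneq x 0.
    exists a; split=> // y; rewrite inE => /orP[/eqP ->|/ha //].
    by left; rewrite normr0.
  exists (Num.min a `|x|); split; first by rewrite lt_min a0 normr_gt0.
  move=> y; rewrite inE => /orP[/eqP ->|/ha[->|ay]]; [right|by left|right].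
    by rewrite ge_min lexx orbT.
  by rewrite ge_min ay.
pose B := \sum_(x <- s) `|x|.
exists a, (Num.truncn (B / a)).+1; split=> // x xs; split; first exact: ha.
apply: (@le_lt_trans _ _ B).
  by rewrite /B (big_rem x) //= lerDl sumr_ge0.
rewrite mulrC -ltr_pdivrMr //; apply: lt_le_trans (truncnS_gt _) _.
by rewrite -natrX ler_nat ltnW // ltn_expl.
Qed.

End DyadicLevels.

(** * The capacitary strong type inequality at a center *)

Section StrongType.
Variables (T : cubicTree) (r : T) (R : realType).
Variable mu : probability (borelTbar r) R.
Hypothesis mu0 : forall x, mu [set (Vertex r x : borelTbar r)] = 0%E.
Variables (M : R) (o : T).
Hypothesis M0 : 0 <= M.
Hypothesis hM : cap_bound mu M.
Hypothesis center : forall y, adj o y ->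
  mass mu (subtree_bar o y : set (borelTbar r)) <= 2^-1.
Implicit Types (x y : T) (F G : T -> R).

Definition slice_of (b : R) G : T -> R := fun v => slice b (2 * b) `|G v|.

Lemma fin_grad_slice b G : fin_grad G -> fin_grad (slice_of b G).
Proof. by move=> fG; apply: fin_grad_le fG _ => a c _; rewrite /slice_of => ->. Qed.

Lemma measurable_level G (t : R) : fin_grad G ->
  measurable [set z : borelTbar r | t <= `|extend G z|].
Proof.
move=> fG; rewrite -[X in measurable X]setTI.
apply: (measurable_fun_le (f := cst t) (g := fun z => `|extend G z|)) => //.
by apply: measurableT_comp => //; exact: extend_measurable.
Qed.

(** The truncation of [G] between the levels [b] and [2 b], restricted to one
    branch at the center, competes in the condenser formed by the part of that
    branch where [G] is large and by the complementary branch, of mass at least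
    a half. *)
Lemma capacitary_weak_type (b : R) G : 0 < b -> fin_grad G -> G o = 0 ->
  b ^+ 2 * mass mu [set z | 2 * b <= `|extend G z|] <=
    6 * M * energy (slice_of b G).
Proof.
move=> b0 fG Go; have [s [ss sE]] := adj_enum o.
set U := slice_of b G; have fU : fin_grad U by exact: fin_grad_slice.
have Uo : U o = 0 by rewrite /U /slice_of /slice Go normr0 !min_l ?subrr ?ltW // mulr_gt0.
pose H y v := \1_(subtree o y) v * (b^-1 * U v).
(* On each edge, the cut-off either kills the increment or leaves it unchanged:
   U vanishes at the center, so cutting the edge issued from it costs nothing. *)
have HE y : adj o y -> forall a c, adj a c ->
    H y a - H y c = 0 \/ H y a - H y c = b^-1 * U a - b^-1 * U c.
  move=> oy a c ac; rewrite /H.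
  have [->|ne] := eqVneq (\1_(subtree o y) a : R) (\1_(subtree o y) c).
    rewrite indicE; case: (c \in _); [right|left]; rewrite ?mul1r //.
    by rewrite !mul0r subrr.
  have io : (\1_(subtree o y) o : R) = 0.
    by rewrite indicE memNset //; exact: subtree_avoids.
  have iy : (\1_(subtree o y) y : R) = 1.
    by rewrite indicE mem_set //; exact: subtree_root.
  have := indic_subtree_edge oy ac ne; rewrite !inE.
  by case/orP => /eqP[-> ->]; right; rewrite io iy Uo mulr0 mul1r ?mul0r.
have fH y : adj o y -> fin_grad (H y).
  move=> oy; apply: fin_grad_le fU _ => a c ac e.
  by apply/eqP; rewrite -subr_eq0; case: (HE y oy a c ac) => -> //; rewrite e subrr.
have EH y : adj o y -> energy (H y) <= b ^- 2 * energy U.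
  move=> oy; rewrite -exprVn -energyZ //; apply: energy_le; first exact: fH.
    by apply: fin_grad_le fU _ => a c _ ->.
  by move=> a c ac; case: (HE y oy a c ac) => -> //; rewrite expr0n sqr_ge0.
pose A y := [set xi : boundary r | extend (H y) (End xi) = 1].
have fA y : adj o y -> finite_union_of_arcs (A y).
  by move=> oy; apply: level_set_arcs; exact: fH.
have mA y : adj o y -> b ^+ 2 * mass mu (@End T r @` A y) <= 2 * M * energy U.
  move=> oy; have yo : adj y o by rewrite adj_sym.
  have H0 xi : arc y o xi -> extend (H y) (End xi : borelTbar r) = 0.
    move=> hxi; apply: extend_eq.
    have h : approach (End xi) (subtree y o) by [].
    apply: filterS h => v hv; rewrite /H indicE memNset ?mul0r // => hv'.
    exact: subtree_disjoint oy hv' hv.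
  have dis : A y `&` arc y o = set0.
    rewrite -subset0 => xi [h1 /H0]; rewrite h1 => /eqP.
    by rewrite oner_eq0.
  have := hM (fA y oy) (arc_finite_union r yo) dis (fH y oy) (fun _ h => h) H0.
  rewrite mass_arc // (massC mu oy); have := center oy.
  set p := mass _ _; set q := mass _ _ => p12 pq.
  have q0 : 0 <= q by exact: mass_ge0.
  have e1 := EH y oy; have e2 : q * (1 - p) <= M * (b ^- 2 * energy U).
    by apply: (le_trans pq); exact: ler_wpM2l.
  rewrite mulrC -ler_pdivlMr ?exprn_gt0 //.
  rewrite (_ : 2 * M * energy U / b ^+ 2 = 2 * (M * (b ^- 2 * energy U))); last by ring.
  nra.
pose L := [set z : borelTbar r | 2 * b <= `|extend G z|].
have large xi : L (End xi) -> exists2 y, y \in s & A y xi.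
  rewrite /L /= -/(extend G (End xi : borelTbar r)) => hL.
  have nearG := extend_near (End xi : borelTbar r) fG.
  case: (bar_branch_cover o (End xi)) => [//|[y oy /subtree_barE hy]].
  exists y; first by rewrite -sE.
  suff : extend (H y) (End xi) = 1 by [].
  apply: extend_eq; apply: filterS2 nearG hy => v Gv hv.
  rewrite /H indicE mem_set // mul1r /U /slice_of /slice Gv.
  rewrite !min_r //; last by apply: le_trans hL; rewrite ler_pMl // ler1n.
  by rewrite mulrDl mul1r addrK mulVf ?gt_eqF.
case: s ss sE large => [|y1 [|y2 [|y3 [|]]]] // _ sE large.
have o1 : adj o y1 by rewrite sE !inE eqxx.
have o2 : adj o y2 by rewrite sE !inE eqxx orbT.
have o3 : adj o y3 by rewrite sE !inE eqxx !orbT.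
have m1 := measurable_arcs (fA _ o1); have m2 := measurable_arcs (fA _ o2).
have m3 := measurable_arcs (fA _ o3); have m12 := measurableU _ _ m1 m2.
have m123 := measurableU _ _ m12 m3.
have eU : @End T r @` (A y1 `|` A y2 `|` A y3) =
    @End T r @` A y1 `|` @End T r @` A y2 `|` @End T r @` A y3 :> set (borelTbar r).
  by rewrite !image_setU.
have mL : measurable L by exact: measurable_level.
have LU : mass mu L <= mass mu (@End T r @` A y1 `|` @End T r @` A y2 `|` @End T r @` A y3).
  rewrite -lee_fin -!massE // -eU; apply: mu_le_ends => //.
    by rewrite eU.
  move=> xi /large[y]; rewrite !inE => /or3P[] /eqP -> h.
  - by left; left.
  - by left; right.
  - by right.
have u1 := massU_le mu m12 m3; have u2 := massU_le mu m1 m2.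
have b2 : 0 <= b ^+ 2 by exact: sqr_ge0.
have := mA _ o1; have := mA _ o2; have := mA _ o3.
have := ler_wpM2l b2 (le_trans LU (le_trans u1 (lerD u2 (lexx _)))).
rewrite -/L -/U; lra.
Qed.

Hypothesis M6 : 6^-1 <= M.

(** Split [F] into the constant [F o] and a function [G] vanishing at the center.
    The square of [G] is dominated by the dyadic sum of its level sets, the weak
    type inequality bounds each level by the energy of one slice of [G], and the
    energies of the slices add up to at most the energy of [G]. The layer
    indexed by [None] carries the constant, which is absorbed because [M] is
    bounded below. *)
Lemma center_carleson F : fin_grad F ->
  (\int[mu]_z (`|extend F z| ^+ 2)%:E
     <= (192 * M * (`|F o| ^+ 2 + energy F))%:E)%E.
Proof.
move=> fF; pose G v := F v - F o.
have fG : fin_grad G by apply: fin_grad_le fF _ => a c _; rewrite /G => ->.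
have eG z : extend G (z : borelTbar r) = extend F z - F o.
  by apply: (@extend_comp _ _ _ F G (fun t => t - F o)).
have Go : G o = 0 by rewrite /G subrr.
have [s hs] := finite_range fG; have [a [n [a0 han]]] := finite_levels s.
pose b k := a / 2 * 2 ^+ k.
have b0 k : 0 < b k by rewrite mulr_gt0 ?exprn_gt0 // divr_gt0.
have bS k : b k.+1 = 2 * b k by rewrite /b exprS; ring.
have b2 k : 2 * b k = a * 2 ^+ k by rewrite /b; lra.
pose L k := [set z : borelTbar r | 2 * b k <= `|extend G z|].
have mL k : measurable (L k) by exact: measurable_level.
(* The levels 2 b k start at a, below the nonzero values of |G|, and end above
   its largest value. *)
pose t := None :: [seq Some k | k <- iota 0 n].
pose c (i : option nat) : R :=
  if i is Some k then 32 * b k ^+ 2 else 2 * `|F o| ^+ 2.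
pose S (i : option nat) := if i is Some k then L k else setT.
have mS i : measurable (S i) by case: i => [k|]; [exact: mL|exact: measurableT].
apply: (@le_trans _ _ (\int[mu]_z (\sum_(i <- t) c i * \1_(S i) z)%:E)%E).
  apply: ge0_le_integral => //.
  - apply/measurable_EFinP; apply: (measurable_funX 2).
    by apply: measurableT_comp => //; exact: extend_measurable.
  - apply/measurable_EFinP; apply: measurable_sum => i.
    by apply: measurable_funM; [exact: measurable_cst|exact: measurable_indic].
  move=> z _; rewrite lee_fin /t big_cons big_map /= indicT mulr1.
  have [v ev] := extend_val z fG; have [h1 h2] := han _ (hs v).
  have := sqr_le_dyadic a0 h1 h2; rewrite -ev => hdy.
  apply: (@le_trans _ _ (2 * `|F o| ^+ 2 + 2 * `|extend G z| ^+ 2)).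
    rewrite !real_normK ?num_real // eG.
    rewrite -subr_ge0 (_ : _ - _ = (extend F z - 2 * F o) ^+ 2) ?sqr_ge0 //; ring.
  rewrite lerD2l mulrC -ler_pdivlMr //; apply: (le_trans hdy).
  rewrite mulr_suml; apply: ler_sum => k _; rewrite -b2 indicE.
  rewrite (_ : (z \in L k) = (2 * b k <= `|extend G z|)); last by apply/idP/idP; rewrite inE.
  by rewrite le_eqVlt; apply/orP; left; apply/eqP; field.
rewrite integral_layers; last 2 first.
- by case=> [k|] /=; rewrite mulr_ge0 // sqr_ge0.
- exact: mS.
rewrite lee_fin /t big_cons big_map /= massT mulr1.
have le1 : \sum_(k <- iota 0 n) 32 * b k ^+ 2 * mass mu (L k) <=
    192 * M * \sum_(k <- iota 0 n) energy (slice_of (b k) G).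
  rewrite mulr_sumr; apply: ler_sum => k _.
  have := capacitary_weak_type (b0 k) fG Go; rewrite -/(L k); lra.
have le2 : \sum_(k <- iota 0 n) energy (slice_of (b k) G) <= energy G.
  have := @energy_sum_le T R _ _ (iota 0 n) [:: tt] (fun k => slice_of (b k) G) (fun=> G).
  rewrite big_seq1; apply=> // [k _|x y _]; first exact: fin_grad_slice.
  rewrite big_seq1; apply: (@le_trans _ _ ((`|G x| - `|G y|) ^+ 2)).
    have bm k : b k <= b k.+1 by rewrite bS ler_peMl ?ler1n // ltW.
    rewrite (eq_bigr _ (fun k _ => congr1 (fun t =>
      (slice (b k) t `|G x| - slice (b k) t `|G y|) ^+ 2) (esym (bS k)))).
    exact: slice_sum_sqr.
  rewrite -[leLHS]real_normK ?num_real // -[leRHS]real_normK ?num_real //.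
  by rewrite ler_sqr ?nnegrE // ler_dist_dist.
have le3 : energy G <= energy F.
  by apply: energy_le => // x y _; rewrite /G opprB addrA subrK.
have M192 : 0 <= 192 * M by rewrite mulr_ge0.
have := ler_wpM2l M192 (le_trans le2 le3).
have M2 : 2 <= 192 * M by move: M6; lra.
have := ler_wpM2r (sqr_ge0 `|F o|) M2; rewrite mulrDr; lra.
Qed.

End StrongType.

(** * Comparison of the three constants *)

Section Comparison.
Variables (T : cubicTree) (r : T) (R : realType).
Variable mu : probability (borelTbar r) R.

Notation carleson_inf := (ereal_inf [set carleson_const mu o | o in [set: T]]).

Lemma poincare_ge0 : (0 <= poincare_const mu)%E.
Proof. by apply: le_ereal_inf_tmp => _ [K [K0 _] <-]; rewrite lee_fin. Qed.

Lemma poincare_le_carleson : (poincare_const mu <= carleson_inf)%E.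
Proof.
apply: le_ereal_inf_tmp => _ [x0 _ <-]; apply: le_ereal_inf_tmp => _ [K [K0 hK] <-].
apply: ereal_inf_lbound; exists K => //; split=> //.
exact: carleson_set_poincare_set hK.
Qed.

Lemma capacity_le_poincare : (capacity_const mu <= poincare_const mu)%E.
Proof.
apply: le_ereal_inf_tmp => _ [K [K0 hK] <-].
apply: cap_bound_capacity_const => //; exact: poincare_set_cap_bound.
Qed.

Hypothesis mu0 : forall x, mu [set (Vertex r x : borelTbar r)] = 0%E.
Hypothesis nd : ~ is_boundary_dirac mu.

(** If the capacity constant is infinite there is nothing to prove; otherwise
    a center exists, and the Carleson constant is estimated there. The lower
    bound on the constant excludes that the supremum is negative or zero. *)
Lemma carleson_le_capacity : (carleson_inf <= 192%:E * capacity_const mu)%E.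
Proof.
have main (M : R) : 0 <= M -> (capacity_const mu <= M%:E)%E ->
    6^-1 <= M /\ (carleson_inf <= (192 * M)%:E)%E.
  move=> M0 cM; have hM := capacity_const_cap_bound M0 cM.
  have [x0 ho] := exists_center mu0 M0 hM nd.
  have M6 := center_lower_bound mu0 hM ho; split=> //.
  apply: (@le_trans _ _ (carleson_const mu x0)).
    by apply: ereal_inf_lbound; exists x0.
  apply: ereal_inf_lbound; exists (192 * M) => //; split.
    by rewrite mulr_ge0.
  by move=> F; exact: center_carleson.
case: (capacity_const mu) main => [k| |] main.
- have [k0|/ltW k0] := leP 0 k.
    by rewrite -EFinM; exact: (main k k0 (lexx _)).2.
  have [] := main 0 (lexx _); first by rewrite lee_fin.
  by rewrite leNgt invr_gt0 ltr0n.
- by rewrite gt0_muley ?lte_fin // leey.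
- by have [] := main 0 (lexx _) (leNye _); rewrite leNgt invr_gt0 ltr0n.
Qed.

End Comparison.

Lemma comparable_with_le (R : realType) (D : R) (X Y : \bar R) : 1 <= D ->
  (0 <= X)%E -> (0 <= Y)%E -> (X <= D%:E * Y)%E -> (Y <= D%:E * X)%E ->
  comparable_with D^-1 D X Y.
Proof.
move=> D1 X0 Y0 XY YX; split=> //.
by rewrite lee_pdivrMl // (lt_le_trans ltr01).
Qed.

Theorem theorem20 (R : realType) :
  exists c C : R, 0 < c /\ c <= C /\
    forall (T : cubicTree) (r : T) (mu : probability (borelTbar r) R),
      (forall x : T, mu [set (Vertex r x : borelTbar r)] = 0%E) ->
      ~ is_boundary_dirac mu ->
      [/\ comparable_with c C (poincare_const mu)
            (ereal_inf [set carleson_const mu o | o in [set: T]]),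
          comparable_with c C (poincare_const mu) (capacity_const mu) &
          comparable_with c C
            (ereal_inf [set carleson_const mu o | o in [set: T]])
            (capacity_const mu)].
Proof.
exists 192^-1, 192; split; first by rewrite invr_gt0.
split; first lra.
move=> T r mu mu0 nd.
have P0 := poincare_ge0 mu; have PI := poincare_le_carleson mu.
have KP := capacity_le_poincare mu; have IK := carleson_le_capacity mu0 nd.
set P := poincare_const mu in P0 PI KP *.
set I := ereal_inf _ in PI IK *; set K := capacity_const mu in KP IK *.
have I0 : (0 <= I)%E by exact: le_trans P0 PI.
have K0 : (0 <= K)%E.
  by have := le_trans I0 IK; rewrite pmule_rge0 // lte_fin.
have up (X Y : \bar R) : (0 <= Y)%E -> (X <= Y)%E -> (X <= 192%:E * Y)%E.
  move=> Y0 XY; apply: (le_trans XY); apply: lee_pemull => //.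
  by rewrite lee_fin ler1n.
have D1 : (1 : R) <= 192 by lra.
have KI := le_trans KP PI; have PK := le_trans PI IK.
have IP : (I <= 192%:E * P)%E by apply: (le_trans IK); rewrite lee_pmul2l.
by split; apply: comparable_with_le => //; apply: up.
Qed.
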